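(* Let $3\le n\le\infty$, let $G\le\mathrm{Homeo}(D_n)$ be a subgroup which is transitive on $\mathrm{Br}(D_n)$, and let $\Gamma\le\mathrm{Sym}(n)$ be a permutation group representing the isomorphism type of the local action of $G$. If $\Gamma$ is doubly transitive on $[n]$, then there is a kaleidoscopic coloring $c$ of $D_n$ such that $G\le\mathcal{K}_c(\Gamma)$.
   Context: A dendrite is a locally connected continuum (non-empty compact connected metrizable space) containing no simple closed curve. Any two distinct points $x,y$ of a dendrite $X$ are joined by a unique arc $[x,y]$; put $(x,y)=[x,y]\setminus\{x,y\}$. For $x\in X$, $\widehat{x}=\pi_0(X\setminus\{x\})$ is the (at most countable) set of components of $X\setminus\{x\}$; $x$ is a branch point if $|\widehat{x}|\ge 3$, and $\mathrm{Br}(X)$ is the (at most countable) set of branch points. For $3\le n\le\infty$ ($\infty$ meaning countably infinite), the Ważewski dendrite $D_n$ is the dendrite, unique up to homeomorphism, which is not a single point, in which $|\widehat{x}|=n$ for every branch point $x$, and in which $(x,y)$ contains a branch point for all $x\ne y$. Write $[n]=\{m\in\mathbf{N}: m<n\}$ (so $[\infty]=\mathbf{N}\ni 0$) and $\mathrm{Sym}(n)$ for the group of all permutations of $[n]$. If $G\le\mathrm{Homeo}(D_n)$ is transitive on $\mathrm{Br}(D_n)$, then for $x\in\mathrm{Br}(D_n)$ the stabilizer $G_x$ induces a permutation group of the $n$-element set $\widehat{x}$; the isomorphism type of this permutation group does not depend on $x$ and is called the local action of $G$. That $\Gamma\le\mathrm{Sym}(n)$ represents it means that some bijection $\widehat{x}\to[n]$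 conjugates the permutation group induced by $G_x$ on $\widehat{x}$ onto $\Gamma$. A coloring of $D_n$ is a map $c$ from $\widehat{D_n}=\bigsqcup_{x\in\mathrm{Br}(D_n)}\widehat{x}$ to $[n]$ whose restriction $c_x=c|_{\widehat{x}}$ is a bijection $\widehat{x}\to[n]$ for each $x\in \mathrm{Br}(D_n)$; for $y\ne x$, $c_x(y)$ denotes the color of the component of $D_n\setminus\{x\}$ containing $y$. The coloring is kaleidoscopic if for all distinct $x,y\in\mathrm{Br}(D_n)$ and all distinct $i,j\in[n]$ there is $z\in(x,y)\cap\mathrm{Br}(D_n)$ with $c_z(x)=i$ and $c_z(y)=j$. For $g\in\mathrm{Homeo}(D_n)$ and $x\in\mathrm{Br}(D_n)$ put $\sigma_c(g,x)=c_{g(x)}\circ g\circ c_x^{-1}\in\mathrm{Sym}(n)$, where $g$ is viewed as a bijection $\widehat{x}\to\widehat{g(x)}$. Finally $\mathcal{K}_c(\Gamma)=\{g\in\mathrm{Homeo}(D_n):\sigma_c(g,x)\in\Gamma\ \text{for all } x\in\mathrm{Br}(D_n)\}$. *)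

(* Defs.v *)
From HB Require Import structures.
From mathcomp Require Import all_boot all_order all_algebra.
From mathcomp Require Import all_classical all_reals all_analysis.
Set Implicit Arguments.
Unset Strict Implicit.
Unset Printing Implicit Defensive.
Import Order.TTheory GRing.Theory Num.Theory.
Import numFieldNormedType.Exports.
Local Open Scope classical_set_scope.
Local Open Scope card_scope.
Local Open Scope ring_scope.

Section Homeomorphisms.
Variables X Y : topologicalType.

Definition homeomorphism (f : X -> Y) : Prop :=
  continuous f /\ exists g : Y -> X, [/\ continuous g, cancel f g & cancel g f].

(* [f] restricts to a homeomorphism from the subspace [A] onto the subspace
   [B]; the values of [f] outside [A] are irrelevant. *)
Definition homeomorphism_on (A : set X) (B : set Y) (f : X -> Y) : Prop :=
  [/\ set_bij A B f, {within A, continuous f} &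
      exists2 g : Y -> X, {within B, continuous g} & {in A, cancel f g}].

End Homeomorphisms.

Section Dendrites.
Variable R : realType.

Definition circle : set (R * R) := [set p | p.1 ^+ 2 + p.2 ^+ 2 = 1].

Variable X : topologicalType.

Definition metrizable : Prop :=
  exists (M : metricType R) (f : X -> M), homeomorphism f.

Definition locally_connected : Prop :=
  forall (x : X) (U : set X), nbhs x U ->
    exists V : set X, [/\ open V, V x, connected V & V `<=` U].

Definition continuum : Prop :=
  [/\ [set: X] !=set0, compact [set: X], connected [set: X] & metrizable].

Definition simple_closed_curve (C : set X) : Prop :=
  exists f : R * R -> X, homeomorphism_on circle C f.

Definition dendrite : Prop :=
  [/\ continuum, locally_connected & forall C : set X, ~ simple_closed_curve C].

Definition joining_arc (x y : X) (A : set X) : Prop :=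
  exists f : R -> X, [/\ homeomorphism_on (`[0, 1] : set R) A f, f 0 = x & f 1 = y].

(* In a dendrite there is exactly one such [A] when [x != y], so [xget] returns
   it. In other spaces [arc x y] is [set0] when no arc joins [x] to [y]. *)
Definition arc (x y : X) : set X := xget set0 (joining_arc x y).

Definition open_arc (x y : X) : set X := arc x y `\` [set x; y].

End Dendrites.

Section Branches.
Variable X : topologicalType.

Definition component (x y : X) : set X := connected_component (~` [set x]) y.

Definition components (x : X) : set (set X) := component x @` (~` [set x]).

Definition Br : set X := [set x | `I_3 #<= components x].

End Branches.
Arguments Br : clear implicits.

(* [Some k] stands for the finite cardinal k, and [None] for the countably
   infinite one. *)
Definition index_set (n : option nat) : set nat :=
  [set m | if n is Some k then (m < k)%N else true].

Definition at_least3 (n : option nat) : Prop :=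
  if n is Some k then (3 <= k)%N else True.

Definition wazewski (R : realType) (n : option nat) (X : topologicalType) :=
  [/\ dendrite R X,
      exists x y : X, x <> y,
      forall x : X, Br X x -> components x #= index_set n &
      forall x y : X, x <> y -> (open_arc R x y `&` Br X) !=set0].

Section PermutationGroups.
Variable T : Type.

(* The last clause makes every element of [G] a bijection. *)
Definition perm_group (G : set (T -> T)) : Prop :=
  [/\ G id,
      forall f g, G f -> G g -> G (f \o g) &
      forall f, G f -> exists2 g, G g & cancel f g /\ cancel g f].

Definition transitive_on (G : set (T -> T)) (A : set T) : Prop :=
  forall x y : T, A x -> A y -> exists2 g, G g & g x = y.

Definition doubly_transitive (G : set (T -> T)) : Prop :=
  forall i j k l : T, i <> j -> k <> l ->
    exists2 g, G g & g i = k /\ g j = l.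

Definition stabilizer (G : set (T -> T)) (x : T) : set (T -> T) :=
  [set g | G g /\ g x = x].

End PermutationGroups.

Definition homeo_group (X : topologicalType) (G : set (X -> X)) : Prop :=
  perm_group G /\ forall g, G g -> homeomorphism g.

Section LocalAction.
Variables (X : topologicalType) (n : option nat).

(* The permutation [s] is phi o g o phi^-1, where [g] acts on components by
   direct image. *)
Definition local_action_at (G : set (X -> X)) (x : X)
    (phi : set X -> index_set n) : set (index_set n -> index_set n) :=
  [set s | exists2 g, stabilizer G x g &
           forall C, components x C -> s (phi C) = phi (g @` C)].

(* For [G] transitive on branch points, the choice of [x] is immaterial. *)
Definition represents_local_action (G : set (X -> X))
    (Gamma : set (index_set n -> index_set n)) : Prop :=
  exists2 x, Br X x &
  exists2 phi : set X -> index_set n,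
    set_bij (components x) [set: index_set n] phi &
    Gamma = local_action_at G x phi.

(* A coloring assigns [c x C] to the component [C] of the complement of the
   branch point [x]; other values of [c] are irrelevant. *)
Definition coloring (c : X -> set X -> index_set n) : Prop :=
  forall x, Br X x -> set_bij (components x) [set: index_set n] (c x).

Definition color_at (c : X -> set X -> index_set n) (x y : X) : index_set n :=
  c x (component x y).

Definition kaleidoscopic (R : realType) (c : X -> set X -> index_set n) : Prop :=
  coloring c /\
  forall (x y : X) (i j : index_set n), Br X x -> Br X y -> x <> y -> i <> j ->
    exists2 z, (open_arc R x y `&` Br X) z &
               color_at c z x = i /\ color_at c z y = j.

Definition local_cocycle (c : X -> set X -> index_set n) (g : X -> X) (x : X) :
    index_set n -> index_set n :=
  fun i => c (g x) (g @` ('pinv_(fun=> set0) (components x) (c x) i)).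

Definition kaleidoscopic_group (c : X -> set X -> index_set n)
    (Gamma : set (index_set n -> index_set n)) : set (X -> X) :=
  [set g | homeomorphism g /\
           forall x, Br X x -> Gamma (local_cocycle c g x)].

End LocalAction.

(* Main.v *)
Require Import Defs.
From mathcomp Require Import all_boot all_order all_algebra.
From mathcomp Require Import all_classical all_reals all_analysis.
From mathcomp Require Import lra.
Set Implicit Arguments.
Unset Strict Implicit.
Unset Printing Implicit Defensive.
Import Order.TTheory GRing.Theory Num.Theory.
Import numFieldNormedType.Exports.
Local Open Scope classical_set_scope.
Local Open Scope ring_scope.

(** Colorings obtained by transporting a fixed coloring at one branch point
    along elements of [G], then twisting it at each branch point by an element
    of [Gamma], always have [G] inside their kaleidoscopic group. There are
    countably many conditions (x, y, i, j) in the definition of kaleidoscopic;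
    each of them is met by choosing the twist at a single branch point of the
    open arc from x to y, thanks to double transitivity, and these branch
    points can be taken distinct because the arc contains infinitely many.

    The topological input is that arcs of a dendrite are unique and that an
    interior point z of [x, y] separates x from y. If it did not, x and y would
    be joined by a path avoiding z (chains of small connected sets converge to
    a path), hence by an arc avoiding z (erase a maximal set of loops, then
    reparametrize), and two distinct arcs with the same endpoints contain a
    simple closed curve. *)

(** * Paths in locally connected compact metric spaces *)

(** If [h x] in [G] moves [x] to the base point, then [h (g x)] after [g] after the inverse of [h x]
    fixes the base point, so it permutes the components there by an element of [Gamma]. The twists
    only multiply this permutation on both sides by elements of [Gamma]: that is why [G] stays in
    the group whatever the twists are. Separation links the conditions to double transitivity: it
    puts the ends of the arc in different components at the chosen point, so their colors are
    distinct and can be moved to [i] and [j]. Countability of the conditions comes from that of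
    [Br X]: a branch point is determined by three points in different components of its complement,
    and these can be taken in a countable dense set. The obstacle in the topology is that the
    definition of a dendrite only forbids circles. A failure of separation has to produce an
    embedded circle, hence the passage from connected sets to paths and from paths to injective
    paths. *)

Lemma invS_lt (R : realType) (e : R) : 0 < e -> exists n, n.+1%:R^-1 < e.
Proof.
move=> e0; exists (Num.truncn e^-1).
by rewrite -[ltRHS]invrK ltf_pV2 ?posrE ?ltr0n ?invr_gt0 // truncnS_gt.
Qed.

(** Tells which cell of a grid contains a given cell of its [k]-fold refinement, so that successive
    approximations of a path can be compared. Negative [x] is harmless because both truncations are
    then [0]. *)
Lemma truncnM_divn (R : realType) (x : R) k :
  (0 < k)%N -> (Num.truncn (x * k%:R) %/ k)%N = Num.truncn x.
Proof.
move=> k0; have [x0|x0] := leP 0 x; last first.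
  have xk : x * k%:R < 1%:R.
    by apply: lt_trans (ltr01); rewrite nmulr_rlt0 // ltr0n.
  have : (Num.truncn (x * k%:R) <= 0)%N by rewrite truncn_le_nat.
  have : (Num.truncn x <= 0)%N by rewrite truncn_le_nat (lt_trans x0).
  by rewrite !leqn0 => /eqP -> /eqP ->; exact: div0n.
apply/esym/eqP; rewrite truncn_eq //; apply/andP; split.
  rewrite -(@ler_pM2r _ k%:R) ?ltr0n // -natrM.
  apply: le_trans (_ : (Num.truncn (x * k%:R))%:R <= _).
    by rewrite ler_nat leq_divM.
  by rewrite truncn_le mulr_ge0.
rewrite -(@ltr_pM2r _ k%:R) ?ltr0n // -natrM.
by apply: lt_le_trans (truncnS_gt _) _; rewrite ler_nat ltn_ceil.
Qed.

Lemma truncn_near (R : realType) (x y : R) :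
  `|x - y| < 1 -> (Num.truncn x <= (Num.truncn y).+1)%N.
Proof.
rewrite truncn_le_nat ltr_norml => /andP[_ xy].
by have := truncnS_gt y; rewrite -[_.+2]addn1 natrD; lra.
Qed.

Lemma continuous_affine (R : realType) (T : topologicalType) (f : R -> T)
  (a b : R) : continuous f -> continuous (fun t : R => f (a * t + b)).
Proof.
move=> cf t; apply: (@cvg_comp _ _ _ (fun t : R => a * t + b) f _ (nbhs (a * t + b))).
  by apply: cvgD; [apply: cvgM; [exact: cvg_cst|exact: cvg_id]|exact: cvg_cst].
exact: cf.
Qed.

Lemma compact_directed (T : topologicalType) (A : set T) (U : nat -> set T) :
  compact A -> (forall m n, (m <= n)%N -> U m `<=` U n) ->
  (forall x, A x -> exists n, nbhs x (U n)) -> exists n, A `<=` U n.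
Proof.
move=> /compact_near_coveringP cA Umono AU.
have [n _ /(_ n (leqnn n))] : \forall n \near \oo, A `<=` U n.
  apply: cA => x /AU[n xUn]; exists (U n, [set m | (n <= m)%N]).
    by split => //=; exists n.
  by move=> [y m] [/= Uy nm]; exact: Umono Uy.
by exists n.
Qed.

Lemma compact_finite_cover (T : topologicalType) (A : set T) (V : T -> set T) :
  compact A -> (forall x, A x -> nbhs x (V x)) ->
  exists s : seq T, A `<=` [set x | exists2 v, v \in s & V v x].
Proof.
move=> /compact_near_coveringP cA AV.
(* Finite lists directed by inclusion: the near-covering form of compactness along this filter
   yields a finite subcover. *)
pose F : set_system (seq T) :=
  filter_from [set: seq T] (fun s => [set t : seq T | {subset s <= t}]).
have FF : Filter F.
  apply: filter_from_filter; first by exists [::].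
  move=> s t _ _; exists (s ++ t) => // u stu.
  by split=> x xs; apply: stu; rewrite mem_cat xs ?orbT.
have [s _ /(_ s (fun _ => id))] :
    \forall s \near F, A `<=` [set x | exists2 v, v \in s & V v x].
  apply: cA => x Ax; exists (V x, [set s | x \in s]).
    split; first exact: AV.
    by exists [:: x] => // s; apply; rewrite mem_head.
  by move=> [y s] [/= Vy xs]; exists x.
by exists s.
Qed.

(** A predicate on a plain function, so that [X] keeps its own topology. The bound [1] makes the
    suprema and weighted sums of distances formed below finite. *)
Definition bounded_metric (R : realType) (X : topologicalType)
    (d : X -> X -> R) : Prop :=
  [/\ forall x y, d x y = 0 <-> x = y, forall x y, d x y = d y x,
      forall x y z, d x z <= d x y + d y z, forall x y, d x y <= 1 &
      forall x U, nbhs x U <-> exists2 e : R, 0 < e & forall y, d x y < e -> U y].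

Lemma metrizable_bounded_metric (R : realType) (X : topologicalType) :
  metrizable R X -> exists d : X -> X -> R, bounded_metric d.
Proof.
move=> [M [f [cf [g [cg fK gK]]]]].
exists (fun x y => Num.min 1 (mdist (f x) (f y))); split.
- move=> x y; split=> [|->]; last first.
    by rewrite mdistxx; apply/min_idPr.
  case: leP => _ /eqP; first by rewrite oner_eq0.
  by move/eqP/mdist_positivity/(can_inj fK).
- by move=> x y; rewrite metric_sym.
- move=> x y z.
  have := metric_triangle (f x) (f y) (f z).
  have := mdist_ge0 (f x) (f y); have := mdist_ge0 (f y) (f z).
  case: (leP 1 (mdist (f x) (f z))); case: (leP 1 (mdist (f x) (f y)));
    by case: (leP 1 (mdist (f y) (f z))); lra.
- by move=> x y; rewrite ge_min lexx.
- move=> x U; split=> [xU|[e e0 eU]].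
    have : nbhs (f x) (g @^-1` U) by apply: cg; rewrite fK.
    move=> /nbhs_ballP[e /= e0 eU]; exists (Num.min 1 e).
      by rewrite lt_min ltr01.
    move=> y xy; rewrite -[y]fK; apply: eU; rewrite ballEmdist /=.
    move: xy; case: (leP 1 e); case: (leP 1 (mdist (f x) (f y))); lra.
  have : nbhs x (f @^-1` ball (f x) e) by apply: cf; exact: nbhsx_ballx.
  apply: filterS => y /=; rewrite ballEmdist /= => xy.
  by apply: eU; rewrite gt_min xy orbT.
Qed.

Section Paths.
Context {R : realType} {X : topologicalType} {d : X -> X -> R}.
Hypothesis d_metric : bounded_metric d.

Lemma bounded_metric_sym x y : d x y = d y x.
Proof. by case: d_metric => _ ->. Qed.

Lemma bounded_metric_triangle y x z : d x z <= d x y + d y z.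
Proof. by case: d_metric. Qed.

Lemma bounded_metric_le1 x y : d x y <= 1.
Proof. by case: d_metric. Qed.

Lemma bounded_metricxx x : d x x = 0.
Proof. by case: d_metric => /(_ x x) [_ ->]. Qed.

Lemma bounded_metric_ge0 x y : 0 <= d x y.
Proof.
have := bounded_metric_triangle y x x.
by rewrite bounded_metricxx (bounded_metric_sym y x); lra.
Qed.

Lemma bounded_metric_gt0 x y : x <> y -> 0 < d x y.
Proof.
move=> xy; rewrite lt_neqAle bounded_metric_ge0 andbT eq_sym.
by apply/eqP; case: d_metric => /(_ x y) [dxy _] _ _ _ _ /dxy.
Qed.

Lemma bounded_metric_nbhs x (U : set X) :
  nbhs x U <-> exists2 e, 0 < e & forall y, d x y < e -> U y.
Proof. by case: d_metric. Qed.

Lemma bounded_metric_nbhs_lt x e : 0 < e -> nbhs x [set y | d x y < e].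
Proof. by move=> e0; apply/bounded_metric_nbhs; exists e. Qed.

Lemma bounded_metric_small x y :
  (forall e, 0 < e -> d x y <= e) -> x = y.
Proof.
move=> xy; apply: contrapT => /bounded_metric_gt0 xy0.
by have := xy (d x y / 2); rewrite divr_gt0 // => /(_ isT); lra.
Qed.

Lemma bounded_metric_continuousP (f : R -> X) : continuous f <->
  forall t e, 0 < e ->
    exists2 r, 0 < r & forall s, `|t - s| < r -> d (f t) (f s) < e.
Proof.
split=> [cf t e e0|cf t U].
  have /nbhs_ballP[r /= r0 rU] :
      nbhs t (f @^-1` [set y | d (f t) y < e]).
    by apply: cf; exact: bounded_metric_nbhs_lt.
  by exists r.
move=> /bounded_metric_nbhs[e e0 eU]; have [r r0 rU] := cf t e e0.
by apply/nbhs_ballP; exists r => // s /rU /eU.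
Qed.

Lemma bounded_metric_hausdorff : hausdorff_space X.
Proof.
move=> x y xy; apply: contrapT => /bounded_metric_gt0 xy0.
have e0 : 0 < d x y / 2 by rewrite divr_gt0.
have [z [/= xz yz]] := xy _ _ (bounded_metric_nbhs_lt x e0)
  (bounded_metric_nbhs_lt y e0).
have := bounded_metric_triangle z x y.
by rewrite (bounded_metric_sym z); lra.
Qed.

(** [c] is a cluster point of [u]; the bounds on distances to later terms pass to it. *)
Lemma Cauchy_limit (u : nat -> X) (e : nat -> R) : compact [set: X] ->
  (forall m n, (m <= n)%N -> d (u m) (u n) <= e m) ->
  exists c, forall n, d (u n) c <= e n.
Proof.
move=> cX ue; have [|c [_ cc]] := cX (u @ \oo); first exact: filterT.
exists c => n; apply/ler_addgt0Pr => r r0.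
have [|y [[m /= nm <-] /= cm]] :=
  cc (u @` [set m | (n <= m)%N]) _ _ (bounded_metric_nbhs_lt c r0).
  by exists n => // m nm; exists m.
have := bounded_metric_triangle (u m) (u n) c.
by have := ue _ _ nm; rewrite (bounded_metric_sym (u m)); lra.
Qed.

(** The number of steps is prescribed because chains will be laid along a common time grid. Points
    may repeat, so a short chain can be padded. *)
Definition chain (C : set X) (e : R) (N : nat) (p q : X) : Prop :=
  exists s : nat -> X, [/\ s 0%N = p, s N = q,
    forall i, (i <= N)%N -> C (s i) &
    forall i, (i < N)%N -> d (s i) (s i.+1) < e].

Lemma chain_trans C e M N p q r :
  chain C e M p q -> chain C e N q r -> chain C e (M + N)%N p r.
Proof.
move=> [s [s0 sM sC se]] [t [t0 tN tC te]].
exists (fun i => if (i <= M)%N then s i else t (i - M)%N); split => //.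
- case: ifP; last by rewrite addKn.
  by rewrite -{2}[M]addn0 leq_add2l leqn0 => /eqP N0; rewrite N0 addn0 sM -tN N0.
- move=> i iMN; case: leqP => iM; first exact: sC.
  by apply: tC; rewrite leq_subLR.
- move=> i iMN; case: (ltngtP i M) => iM.
  + exact: se.
  + rewrite subSn ?(ltnW iM) //; apply: te.
    by rewrite ltn_subLR // ltnW.
  + rewrite iM subSn // subnn sM -t0; apply: te.
    by move: iMN; rewrite iM -{1}[M]addn0 ltn_add2l.
Qed.

Lemma chain_refl (C : set X) e N p : 0 < e -> C p -> chain C e N p p.
Proof.
by move=> e0 Cp; exists (fun=> p); split => // i _; rewrite bounded_metricxx.
Qed.

Lemma chain_le C e M N p q :
  0 < e -> (M <= N)%N -> chain C e M p q -> chain C e N p q.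
Proof.
move=> e0 MN pq; rewrite -(subnKC MN); apply: chain_trans (pq) _.
by apply: chain_refl => //; case: pq => s [_ <- sC _]; exact: sC.
Qed.

Lemma chain_step (C : set X) e p q : C p -> C q -> d p q < e -> chain C e 1 p q.
Proof.
move=> Cp Cq pq; exists (fun i => if i is 0%N then p else q).
by split => // -[].
Qed.

Lemma chain_sym C e N p q : chain C e N p q -> chain C e N q p.
Proof.
move=> [s [s0 sN sC se]]; exists (fun i => s (N - i)%N); split.
- by rewrite subn0.
- by rewrite subnn.
- by move=> i _; apply: sC; exact: leq_subr.
- move=> i iN; rewrite bounded_metric_sym -[(N - i)%N](@prednK (N - i))
    ?subn_gt0 // -subnS.
  by apply: se; rewrite ltn_subrL (leq_trans _ iN).
Qed.

Lemma chain_sub (C D : set X) e N p q :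
  C `<=` D -> chain C e N p q -> chain D e N p q.
Proof. by move=> CD [s [s0 sN sC se]]; exists s; split=> // i /sC /CD. Qed.

(** The points of [C] reached from a fixed [c] form a relatively clopen set, hence all of [C].
    Compactness bounds the number of steps, and passing through [c] makes the bound uniform in both
    endpoints. *)
Lemma compact_connected_chain (C : set X) e : compact C -> connected C ->
  0 < e -> exists N, forall p q, C p -> C q -> chain C e N p q.
Proof.
move=> cC kC e0; have [->|/set0P[c Cc]] := eqVneq C set0; first by exists 0%N.
(* The last step may leave [C], which makes [U n] open in the whole space; at points of [C], [UC]
   turns it into a step of the chain. *)
pose U n := [set y | exists2 x, chain C e n c x & d x y < e].
have UC n y : C y -> U n y -> chain C e n.+1 c y.
  move=> Cy [x cx xy]; rewrite -addn1; apply: chain_trans (cx) _.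
  by apply: chain_step => //; case: cx => s [_ <- sC _]; exact: sC.
have CU : C `&` \bigcup_n U n = C.
  apply: kC.
  - by exists c; split=> //; exists 0%N => //; exists c;
      rewrite ?bounded_metricxx //; exact: chain_refl.
  - exists (\bigcup_n U n) => //; apply: bigcup_open => n _.
    rewrite openE => y [x cx xy]; apply/bounded_metric_nbhs;
      exists (e - d x y); first by lra.
    by move=> z yz; exists x => //; have := bounded_metric_triangle y x z; lra.
  - exists (~` \bigcup_(y in C `\` \bigcup_n U n) [set z | d y z < e]).
      apply: open_closedC; apply: bigcup_open => y _.
      rewrite openE => z /= yz; apply/bounded_metric_nbhs; exists (e - d y z);
        first by lra.
      by move=> w zw /=; have := bounded_metric_triangle z y w; lra.
    apply/seteqP; split=> x [Cx xU]; split => //.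
      move=> [y [Cy yU] /= yx]; apply: yU; case: xU => n _ xU; exists n.+1 => //.
      by exists x; [exact: UC|rewrite bounded_metric_sym].
    apply: contrapT => xU'; apply: xU; exists x => //=.
    by rewrite bounded_metricxx.
have [n Cn] : exists n, C `<=` U n.
  apply: compact_directed => //.
    by move=> m n mn y [x cx xy]; exists x => //; exact: chain_le cx.
  rewrite -{1}CU => x [Cx [n _ [y cy yx]]]; exists n.
  apply/bounded_metric_nbhs; exists (e - d y x); first by lra.
  by move=> z yz; exists y => //; have := bounded_metric_triangle x y z; lra.
exists (n.+1 + n.+1)%N => p q Cp Cq; apply: (@chain_trans _ _ _ _ _ c).
  by apply: chain_sym; apply: UC => //; exact: Cn.
by apply: UC => //; exact: Cn.
Qed.

Hypotheses (X_compact : compact [set: X]) (X_lc : locally_connected X).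

(** Uniform local connectedness: [r] is a Lebesgue number of a finite cover by small connected open
    sets, whose closures are compact and connected, hence chainable at every scale. Since [r] does
    not depend on [r'], the scale of the next refinement can be fixed afterwards. *)
Lemma uniform_chain e : 0 < e -> exists2 r, 0 < r & forall r', 0 < r' ->
  exists N, forall p q, d p q < r -> chain [set y | d p y < e] r' N p q.
Proof.
(* Two points in the closure of a set of radius [e / 4] are at distance at most [e / 2], which
   leaves room for the strict bound [e]. *)
move=> e0; have e40 : 0 < e / 4 by rewrite divr_gt0.
have /choice[V VP] : forall v, exists V : set X,
    [/\ open V, V v, connected V & forall y, V y -> d v y < e / 4].
  move=> v; have [V [oV Vv cV Ve]] := X_lc (bounded_metric_nbhs_lt v e40).
  by exists V; split.
have [|D XD] := @compact_finite_cover _ _ V X_compact.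
  by move=> v _; have [oV Vv _ _] := VP v; exact: open_nbhs_nbhs.
pose U n := [set p | exists2 v, v \in D & forall y, d p y < n.+1%:R^-1 -> V v y].
have [n XU] : exists n, [set: X] `<=` U n.
  apply: compact_directed => // [m n mn p [v vD pV]|x _].
    exists v => // y py; apply: pV; apply: lt_le_trans py _.
    by rewrite lef_pV2 ?posrE ?ltr0n // ler_nat.
  have [v /= vD Vx] := XD x I; have [oV _ _ _] := VP v.
  have /bounded_metric_nbhs[r r0 rV] : nbhs x (V v) by exact: open_nbhs_nbhs.
  have [n nr] : exists n : nat, n.+1%:R^-1 < r / 2.
    by apply: invS_lt; rewrite divr_gt0.
  exists n; apply/bounded_metric_nbhs; exists (r / 2); first by rewrite divr_gt0.
  move=> p xp; exists v => // y py; apply: rV.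
  by have := bounded_metric_triangle p x y; have := lt_trans py nr; lra.
exists n.+1%:R^-1; first by rewrite invr_gt0 ltr0n.
move=> r' r'0.
have Vcl v y : closure (V v) y -> d v y <= e / 4.
  move=> cy; apply/ler_addgt0Pr => s s0.
  have [z [Vz /= yz]] := cy _ (bounded_metric_nbhs_lt y s0).
  have [_ _ _ /(_ _ Vz)] := VP v.
  by have := bounded_metric_triangle z v y; rewrite (bounded_metric_sym z); lra.
have /choice[N NP] : forall v, exists N, forall p q, closure (V v) p -> closure
  (V v) q ->
    chain (closure (V v)) r' N p q.
  move=> v; apply: compact_connected_chain => //.
    by apply: (subclosed_compact _ X_compact) => //; exact: closed_closure.
  by apply: connected_closure; case: (VP v).
exists (\max_(v <- D) N v)%N => p q pq; have [v vD pV] := XU p I.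
have [Vp Vq] : V v p /\ V v q.
  by split; apply: pV => //; rewrite bounded_metricxx invr_gt0 ltr0n.
apply: (@chain_sub (closure (V v))).
  move=> y /Vcl vy /=; have := Vcl _ _ (subset_closure Vp).
  by have := bounded_metric_triangle v p y; rewrite (bounded_metric_sym p v); lra.
apply: (@chain_le _ _ (N v)) => //; first exact: (@leq_bigmax_seq _ _ xpredT).
by apply: NP; exact: subset_closure.
Qed.

Lemma chain_refine N e r r' (f : nat -> X) :
  (forall p q, d p q < r -> chain [set y | d p y < e] r' N.+1 p q) ->
  (forall k, d (f k) (f k.+1) < r) ->
  exists f' : nat -> X, [/\ forall k, f' (k * N.+1)%N = f k,
    forall j, d (f (j %/ N.+1)%N) (f' j) < e &
    forall j, d (f' j) (f' j.+1) < r'].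
Proof.
move=> rchain fr; have /choice[s sP] := fun k => rchain _ _ (fr k).
exists (fun j => s (j %/ N.+1)%N (j %% N.+1)%N); split.
- by move=> k; rewrite mulnK // modnMl; case: (sP k).
- by move=> j; have [_ _ sC _] := sP (j %/ N.+1)%N; apply: sC;
    exact: ltnW (ltn_pmod _ _).
- move=> j; have [_ sN _ se] := sP (j %/ N.+1)%N.
  have jN : (j %% N.+1 < N.+1)%N by rewrite ltn_pmod.
  have := se _ jN; suff -> :
    s (j %/ N.+1)%N (j %% N.+1).+1 = s (j.+1 %/ N.+1)%N (j.+1 %% N.+1)%N by [].
  have := divn_eq j N.+1; move: jN sN; set i := (j %% _)%N;
    set k := (j %/ _)%N => iN sN jki.
  have -> : j.+1 = (k * N.+1 + i.+1)%N by rewrite {1}jki addnS.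
  (* At the end of a block the successor is the first point of the next chain, [f k.+1], which is
     also the last point of the current chain. *)
  rewrite divnMDl // modnMDl; move: iN; rewrite leq_eqVlt => /orP[/eqP [->]|iN].
    by rewrite divnn modnn addn1 sN; case: (sP k.+1).
  by rewrite divn_small // modn_small // addn0.
Qed.

(** Paths live on the whole line and all their values lie in [U], so that gluing and affine changes
    of time involve no subspace topology. *)
Definition path_in (U : set X) (p q : X) : Prop :=
  exists f : R -> X, [/\ continuous f, f 0 = p, f 1 = q & forall t, U (f t)].

(* The n-th approximation [g n] runs through a chain of [M n] steps of size less
   than [r n], each of which is refined into [(N n).+1] steps in the next one. *)
Lemma local_path e : 0 < e ->
  exists2 r, 0 < r & forall p q, d p q < r -> path_in [set y | d p y < e] p q.
Proof.
(* The limit stays within [2 * u 0 = e / 2] of the first approximation, whose values are within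
   [e / 4] of [p]; hence it stays in the ball of radius [e]. *)
move=> e0; pose u n := e / 4 / 2 ^+ n.
have u0 n : 0 < u n by rewrite !divr_gt0 // exprn_gt0.
have uS n : u n.+1 = u n / 2 by rewrite /u exprS invfM [2^-1 * _]mulrC mulrA.
have u_small a : 0 < a -> exists n, u n < a.
  move=> a0; have [|n nr] := @invS_lt _ (a / e); first by rewrite divr_gt0.
  exists n; rewrite /u -mulrA mulrC -ltr_pdivlMr // mulrC -invfM.
  apply: le_lt_trans nr; rewrite lef_pV2 ?posrE ?ltr0n // ?mulr_gt0 ?exprn_gt0 //.
  have : (n.+1%:R : R) <= 2 ^+ n by rewrite -natrX ler_nat ltn_expl.
  by have : (0 : R) < 2 ^+ n by [exact: exprn_gt0]; lra.
have /choice[r rP] : forall n, exists r, [/\ 0 < r, r <= u n & forall r', 0 < r' ->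
    exists N, forall p q, d p q < r -> chain [set y | d p y < u n] r' N.+1 p q].
  move=> n; have [r r0 rc] := uniform_chain (u0 n).
  exists (Num.min r (u n)); split; first by rewrite lt_min r0 u0.
    by rewrite ge_min lexx orbT.
  move=> r' r'0; have [N NP] := rc _ r'0; exists N => p q.
  by rewrite lt_min => /andP[pq _]; apply: chain_le (NP _ _ pq).
have /choice[N NP] : forall n, exists N, forall p q, d p q < r n ->
    chain [set y | d p y < u n] (r n.+1) N.+1 p q.
  by move=> n; have [_ _] := rP n; apply; case: (rP n.+1).
exists (r 0%N); first by case: (rP 0%N).
move=> p q pq.
have /choice[F FP] : forall nf : nat * (nat -> X), exists f' : nat -> X,
    (forall k, d (nf.2 k) (nf.2 k.+1) < r nf.1) ->
    [/\ forall k, f' (k * (N nf.1).+1)%N = nf.2 k,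
      forall j, d (nf.2 (j %/ (N nf.1).+1)%N) (f' j) < u nf.1 &
      forall j, d (f' j) (f' j.+1) < r nf.1.+1].
  move=> [n f] /=; have [fr|nfr] := pselect (forall k, d (f k) (f k.+1) < r n).
    by have [f' f'P] := chain_refine (NP n) fr; exists f'.
  by exists f.
(* [f 0] jumps from [p] to [q] and stays there. Indexing by all of [nat] spares a special case at
   the last step; time [1] is the index [M n], where the value is [q]. *)
pose f := fix f n : nat -> X := if n is n'.+1 then F (n', f n')
  else fun k => if k is 0%N then p else q.
have fr n k : d (f n k) (f n k.+1) < r n.
  elim: n k => [[//|k]|n IHn k] /=; first by rewrite bounded_metricxx; case: (rP 0%N).
  by have [_ _] := FP (n, f n) IHn.
have fk n k : f n.+1 (k * (N n).+1)%N = f n k.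
  by have [fk _ _] := FP (n, f n) (fr n); exact: fk.
have fu n j : d (f n (j %/ (N n).+1)%N) (f n.+1 j) < u n.
  by have [_ fu _] := FP (n, f n) (fr n); exact: fu.
pose M := fix M n : nat := if n is n'.+1 then (M n' * (N n').+1)%N else 1%N.
have M0 n : (0 < M n)%N by elim: n => //= n IHn; rewrite muln_gt0 IHn.
pose g n (t : R) := f n (Num.truncn (t * (M n)%:R)).
have gS n t : d (g n t) (g n.+1 t) < u n.
  rewrite /g -[Num.truncn (t * (M n)%:R)](@truncnM_divn _ _ (N n).+1) //.
  by rewrite -mulrA -natrM; exact: fu.
(* The induction carries the sharper telescoped bound [2 * u m - 2 * u n]. *)
have gu t m n : (m <= n)%N -> d (g m t) (g n t) <= 2 * u m.
  move=> /subnKC <-; apply: (@le_trans _ _ (2 * u m - 2 * u (m + (n - m))%N));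
    last first.
    by have := u0 (m + (n - m))%N; lra.
  elim: (n - m)%N => [|k IHk]; first by rewrite addn0 subrr bounded_metricxx.
  rewrite addnS uS; have :=
    bounded_metric_triangle (g (m + k)%N t) (g m t) (g (m + k).+1 t).
  by have := gS (m + k)%N t; lra.
have /choice[h hP] : forall t, exists c, forall n, d (g n t) c <= 2 * u n.
  by move=> t; apply: Cauchy_limit => // m n; exact: gu.
have u4 : u 0%N = e / 4 by rewrite /u expr0 divr1.
have h_const t x : (forall n, g n t = x) -> h t = x.
  move=> gx; apply/esym/bounded_metric_small => a a0.
  have [|n ua] := u_small (a / 2); first by rewrite divr_gt0.
  by have := hP t n; rewrite gx; lra.
exists h; split.
- apply/bounded_metric_continuousP => t a a0.
  (* Each of the two limits costs [2 * u n], and one step of the grid costs [r n <= u n]: five in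
     all. *)
  have [|n ua] := u_small (a / 5); first by rewrite divr_gt0.
  exists (M n)%:R^-1; first by rewrite invr_gt0 ltr0n.
  move=> s ts.
  (* Times closer than the mesh lie in the same cell of the grid or in adjacent cells. *)
  have gts : d (g n t) (g n s) < r n.
    have nts : `|t * (M n)%:R - s * (M n)%:R| < 1.
      by rewrite -mulrBl normrM normr_nat -ltr_pdivlMr ?ltr0n // div1r.
    have := truncn_near nts; move: nts; rewrite distrC => /truncn_near.
    rewrite /g; set x := Num.truncn _; set y := Num.truncn _.
    rewrite leq_eqVlt => /orP[/eqP ->|]; first by [].
    rewrite ltnS => yx; rewrite leq_eqVlt => /orP[/eqP ->|].
      by rewrite bounded_metric_sym; exact: fr.
    rewrite ltnS => xy; have -> : x = y by apply/eqP; rewrite eqn_leq xy yx.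
    by rewrite bounded_metricxx; case: (rP n).
  have [_ ru _] := rP n.
  have := hP t n; have := hP s n; rewrite (bounded_metric_sym (g n t)).
  have := bounded_metric_triangle (g n t) (h t) (h s).
  by have := bounded_metric_triangle (g n s) (g n t) (h s); lra.
- by apply: h_const => n; rewrite /g mul0r truncn0; elim: n => // n <-;
    have := fk n 0%N; rewrite mul0n.
- apply: h_const => n; rewrite /g mul1r natrK; elim: n => // n <-; exact: fk n (M n).
- move=> t /=; have := hP t 0%N; have [_ ru _] := rP 0%N.
  have : d p (g 0%N t) < e / 4.
    rewrite /g /=; case: (Num.truncn _) => [|_]; last by lra.
    by rewrite bounded_metricxx divr_gt0.
  by have := bounded_metric_triangle (g 0%N t) p (h t); lra.
Qed.

Lemma continuous_glue (f g : R -> X) (a : R) :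
  continuous f -> continuous g -> f a = g a ->
  continuous (fun t => if t <= a then f t else g t).
Proof.
move=> /bounded_metric_continuousP cf /bounded_metric_continuousP cg fga.
apply/bounded_metric_continuousP => t e e0.
have [r1 r10 fr] := cf t e e0; have [r2 r20 gr] := cg t e e0.
have [ta|ta|ta] := ltgtP t a.
- exists (Num.min r1 (a - t)); first by rewrite lt_min r10 subr_gt0.
  move=> s; rewrite lt_min => /andP[/fr ts]; rewrite distrC => /ltr_normlW sa.
  by have -> : s <= a by lra.
- exists (Num.min r2 (t - a)); first by rewrite lt_min r20 subr_gt0.
  move=> s; rewrite lt_min => /andP[/gr ts /ltr_normlW sa].
  by have -> : s <= a = false by apply/negbTE; rewrite -ltNge; lra.
- exists (Num.min r1 r2); first by rewrite lt_min r10.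
  move=> s; rewrite lt_min => /andP[/fr fts /gr]; case: ifP => // _.
  by rewrite ta fga.
Qed.

Lemma path_in_trans U p q r : path_in U p q -> path_in U q r -> path_in U p r.
Proof.
move=> [f [cf f0 f1 fU]] [g [cg g0 g1 gU]].
exists (fun t => if t <= 2^-1 then f (2 * t + 0) else g (2 * t - 1)); split.
- apply: continuous_glue; last by rewrite addr0 divff // subrr f1 g0.
    exact: continuous_affine cf.
  exact: continuous_affine cg.
- by rewrite invr_ge0 ler0n mulr0 addr0.
- have -> : (1 : R) <= 2^-1 = false by apply/negbTE; rewrite -ltNge; lra.
  by rewrite mulr1 (_ : 2 - 1 = 1 :> R) //; lra.
- by move=> t; case: ifP.
Qed.

Lemma path_in_sym U p q : path_in U p q -> path_in U q p.
Proof.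
move=> [f [cf f0 f1 fU]]; exists (fun t => f (- 1 * t + 1)); split=> //.
- exact: continuous_affine cf.
- by rewrite mulr0 add0r.
- by rewrite mulr1 addNr.
Qed.

Lemma path_in_sub U V p q : U `<=` V -> path_in U p q -> path_in V p q.
Proof. by move=> UV [f [cf f0 f1 fU]]; exists f; split => // t; exact: UV. Qed.

(** By [local_path], nearby points of [U] are joined inside [U], so the points of [C] reachable from
    [p] form a relatively clopen set. The path may leave [C], but not [U]. *)
Lemma connected_path (U C : set X) p q : open U -> C `<=` U -> connected C ->
  C p -> C q -> path_in U p q.
Proof.
move=> oU CU kC Cp Cq; pose A := [set x | path_in U p x].
have Aball x : U x -> exists2 r, 0 < r & forall y, d x y < r -> path_in U x y.
  move=> Ux; have /bounded_metric_nbhs[e e0 eU] : nbhs x U by exact: open_nbhs_nbhs.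
  have [r r0 rP] := local_path e0; exists r => // y xy.
  exact: path_in_sub eU (rP _ _ xy).
suff : C `&` A = C by move=> CA; move: Cq; rewrite -CA => -[].
apply: kC.
- exists p; split=> //; exists (fun=> p); split=> //; first exact: cst_continuous.
  by move=> _; exact: CU.
- exists (A `&` U); last by rewrite setIA (setIidl (_ : C `&` A `<=` U)) // =>
    x [/CU].
  rewrite openE => x [pAx Ux]; have [r r0 rP] := Aball _ Ux.
  apply: filterI; last exact: open_nbhs_nbhs.
  by apply/bounded_metric_nbhs; exists r => // y /rP; exact: path_in_trans.
- exists (~` (U `\` A)).
    apply: open_closedC; rewrite openE => x [Ux Ax]; have [r r0 rP] := Aball _ Ux.
    apply: filterI; first exact: open_nbhs_nbhs.
    apply/bounded_metric_nbhs; exists r => // y /rP xy py; apply: Ax.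
    exact: path_in_trans py (path_in_sym xy).
  apply/seteqP; split=> x [Cx Ax]; split=> //; first by case.
  by apply: contrapT => nAx; apply: Ax; split => //; exact: CU.
Qed.

End Paths.

(** * From paths to arcs *)

(** [a] is the supremum of the times up to [t] outside [O]: the left end of the component of [O]
    around [t], or [t] itself if [t] is outside [O]. *)
Lemma last_before (R : realType) (O : set R) (t s : R) : open O -> s <= t -> ~ O s ->
  exists a, [/\ s <= a, a <= t, ~ O a & forall u, a < u -> u <= t -> O u].
Proof.
move=> oO st nOs; have [Ot|nOt] := pselect (O t); last first.
  by exists t; split => // u tu ut; have := lt_le_trans tu ut; rewrite ltxx.
pose A := [set u | u <= t /\ ~ O u].
have As : A s by [].
have A_sup : has_sup A by split; [exists s|exists t => u []].
exists (sup A); split.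
- by apply: ub_le_sup => //; case: A_sup.
- by apply: ge_sup; [exists s|move=> u []].
- move=> OA; have /nbhs_ballP[r /= r0 rO] : nbhs (sup A) O by exact: open_nbhs_nbhs.
  have [u [ut nOu] Au] := sup_adherent r0 A_sup.
  have uA : u <= sup A by apply: ub_le_sup; [case: A_sup|split].
  apply: nOu; apply: rO; rewrite /ball /= ger0_norm; first by lra.
  by rewrite subr_ge0.
- move=> u Au ut; apply: contrapT => nOu.
  have : u <= sup A by apply: ub_le_sup; [case: A_sup|].
  by lra.
Qed.

Lemma first_after (R : realType) (O : set R) (t s : R) : open O -> t <= s -> ~ O s ->
  exists b, [/\ t <= b, b <= s, ~ O b & forall u, t <= u -> u < b -> O u].
Proof.
move=> oO ts nOs.
have [|||a [sa at_ nOa aO]] := @last_before R (-%R @^-1` O) (- t) (- s).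
- by apply: open_comp => // x _; exact: opp_continuous.
- by rewrite lerN2.
- by rewrite /= opprK.
exists (- a); split=> //; [by lra|by lra|].
by move=> u tu ua; rewrite -[u]opprK; apply: aO; lra.
Qed.

(** * Erasing a maximal family of loops *)

Section LoopErasure.
Context {R : realType} {X : topologicalType} {d : X -> X -> R}.
Hypothesis d_metric : bounded_metric d.

(** In the last clause the interval from [a] to [b] is a component of [O], described by its ends;
    collapsing it creates no jump of [f]. *)
Definition loops (f : R -> X) (O : set R) : Prop :=
  [/\ open O, O `<=` `]0, 1[ &
    forall a b, a < b -> ~ O a -> ~ O b -> (forall u, a < u < b -> O u) -> f a = f b].

(** The upper bound for Zorn's lemma. A gap of the union need not be a gap of any member, but a
    slightly smaller segment is compact, so it lies in one member [W]. The gap of [W] around it has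
    ends close to [a] and [b] with equal images, and continuity concludes. *)
Lemma bigcup_loops (f : R -> X) (F : set (set R)) : continuous f ->
  F `<=` loops f -> total_on F subset -> loops f (\bigcup_(W in F) W).
Proof.
move=> /(bounded_metric_continuousP d_metric) cf FP Ftot;
  set O := \bigcup_(W in F) W; split.
- by apply: bigcup_open => W /FP[].
- by move=> t [W /FP[_ + _] Wt]; apply.
move=> a b ab nOa nOb abO; apply: (bounded_metric_small d_metric) => e e0.
have e20 : 0 < e / 2 by rewrite divr_gt0.
have [r1 r10 fr1] := cf a _ e20; have [r2 r20 fr2] := cf b _ e20.
(* The third bound keeps [a' <= b'] below. *)
pose m := (a + b) / 2; pose r := Num.min (Num.min r1 r2) ((b - a) / 2).
have r0 : 0 < r by rewrite !lt_min r10 r20 divr_gt0 // subr_gt0.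
have [rr1 rr2 rm] : [/\ r <= r1, r <= r2 & r <= (b - a) / 2].
  by rewrite /r; split;
    [rewrite !ge_min lexx|rewrite !ge_min lexx orbT|rewrite ge_min lexx orbT].
pose a' := a + r / 2; pose b' := b - r / 2.
have [W0 FW0 _] : O m by apply: abO; rewrite /m; lra.
have /choice[V VP] : forall x, exists V, F V /\ (O x -> V x).
  move=> x; have [[V FV Vx]|nOx] := pselect (O x); first by exists V.
  by exists W0.
have abO' : `[a', b'] `<=` O.
  move=> x; rewrite /= in_itv /= => /andP[ax xb]; apply: abO.
  by move: ax xb; rewrite /a' /b'; lra.
have [|s sP] := compact_finite_cover (V := V) (@segment_compact _ a' b').
  move=> x /abO' Ox; have [FV /(_ Ox) Vx] := VP x.
  by apply: open_nbhs_nbhs; split => //; have [] := FP _ FV.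
have [W FW sW] : exists2 W, F W & forall v, v \in s -> V v `<=` W.
  elim: s {sP} => [|v s [W FW sW]]; first by exists W0.
  have [FV _] := VP v; have [VW|WV] := Ftot _ _ FV FW.
    by exists W => // x; rewrite inE => /orP[/eqP ->|/sW].
  exists (V v) => // x; rewrite inE => /orP[/eqP -> //|/sW xW].
  exact: subset_trans WV.
have {}sW : `[a', b'] `<=` W by move=> x /sP[v vs]; exact: sW.
have [oW W01 Wloop] := FP _ FW.
have nWa : ~ W a by move=> Wa; apply: nOa; exists W.
have nWb : ~ W b by move=> Wb; apply: nOb; exists W.
have [|al [aal ala' nWal alW]] := @last_before _ W a' a oW _ nWa.
  by rewrite /a'; lra.
have [|be [b'be beb nWbe beW]] := @first_after _ W b' b oW _ nWb.
  by rewrite /b'; lra.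
have a'b' : a' <= b' by rewrite /a' /b'; lra.
have albe : al < be.
  rewrite lt_neqAle (le_trans ala' (le_trans a'b' b'be)) andbT; apply/eqP => albe.
  apply: nWal; apply: sW; rewrite /= in_itv /=; rewrite -albe in b'be;
    apply/andP; lra.
have fab : f al = f be.
  apply: Wloop => // u /andP[alu ube]; have [ua'|a'u] := leP u a'; first exact: alW.
  have [b'u|ub'] := leP b' u; first exact: beW.
  by apply: sW; rewrite /= in_itv /= !ltW.
have da : d (f a) (f al) < e / 2.
  by apply: fr1; rewrite distrC ger0_norm ?subr_ge0 //; move: ala'; rewrite /a'; lra.
have db : d (f b) (f be) < e / 2.
  by apply: fr2; rewrite ger0_norm ?subr_ge0 //; move: b'be; rewrite /b'; lra.
have := bounded_metric_triangle d_metric (f al) (f a) (f b).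
by rewrite fab in da *; rewrite (bounded_metric_sym d_metric (f be)); lra.
Qed.

(* Collapsing every gap of a maximal set of loops leaves a path whose fibers
   are intervals. *)
Lemma loop_erasure (f : R -> X) : continuous f ->
  exists g : R -> X, [/\ continuous g, g 0 = f 0, g 1 = f 1,
    forall t, exists s, g t = f s &
    forall s u t, 0 <= s -> s <= u -> u <= t -> t <= 1 -> g s = g t -> g u = g s].
Proof.
move=> cf; have [ O [[oO O01 Oloop] Omax]] :=
  Zorn_bigcup (fun F FP => @bigcup_loops f F cf FP).
(* These times bound every gap, so [l] and [r] below exist at every real [t], and the endpoints [0]
   and [1] are kept. *)
have nO t : t <= 0 \/ 1 <= t -> ~ O t.
  by move=> t01 /O01; rewrite /= in_itv /= => /andP[]; case: t01; lra.
have /choice[l lP] : forall t, exists a, [/\ a <= t, ~ O a & forall u, a < u ->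
  u <= t -> O u].
  move=> t; have [||a [_]] := @last_before _ O t (Num.min 0 t) oO.
  - by rewrite ge_min lexx orbT.
  - by apply: nO; left; rewrite ge_min lexx.
  - by exists a.
have /choice[r rP] : forall t, exists b, [/\ t <= b, ~ O b & forall u, t <= u
  -> u < b -> O u].
  move=> t; have [||b [tb _]] := @first_after _ O t (Num.max 1 t) oO.
  - by rewrite le_max lexx orbT.
  - by apply: nO; right; rewrite le_max lexx.
  - by exists b.
have l_uniq a t : a <= t -> ~ O a -> (forall u, a < u -> u <= t -> O u) -> l t = a.
  move=> at_ nOa aO; have [lt nOl lO] := lP t.
  by case: (ltgtP (l t) a) => // [la|al]; [case: nOa; exact: lO|case: nOl; exact: aO].
have l_id t : ~ O t -> l t = t.
  by move=> nOt; apply: l_uniq => // u tu ut; have := lt_le_trans tu ut; rewrite ltxx.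
have flr t : f (l t) = f (r t).
  have [lt nOl lO] := lP t; have [tr nOr rO] := rP t.
  have := le_trans lt tr; rewrite le_eqVlt => /orP[/eqP -> //|lr].
  apply: Oloop => // u /andP[lu ur].
  by have [ut|tu] := leP u t; [exact: lO|apply: rO => //; exact: ltW].
(* [l] sends a gap to its left end and fixes the complement of [O]. It jumps at the right end of a
   gap, but by [flr] its composite with [f] does not. *)
exists (f \o l); split.
- apply/(bounded_metric_continuousP d_metric) => t e e0 /=.
  have [Ot|nOt] := pselect (O t).
    have /nbhs_ballP[p /= p0 pO] : nbhs t O by exact: open_nbhs_nbhs.
    exists p => // s ts; have [lt nOl lO] := lP t.
    have lp : l t <= t - p.
      rewrite leNgt; apply/negP => lp; apply: nOl; apply: pO.
      by rewrite /ball /= ger0_norm ?subr_ge0 //; lra.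
    have -> : l s = l t; last by rewrite (bounded_metricxx d_metric).
    apply: l_uniq => //; first by move: ts; rewrite ltr_norml => /andP[]; lra.
    move=> u lu us; have [ut|tu] := leP u t; first exact: lO.
    apply: pO; rewrite /ball /=; move: ts; rewrite !ltr_norml => /andP[].
    by move=> ? ?; apply/andP; split; lra.
  have [p p0 pf] := (bounded_metric_continuousP d_metric f).1 cf t e e0.
  rewrite (l_id t) //; exists p => // s ts.
  (* For [t] outside [O], the end of the gap of [s] on the side of [t] lies between [t] and [s], so
     continuity of [f] at [t] applies to it. *)
  have [tls|st] := leP t s.
    have [ls nOl lO] := lP s; apply: pf.
    have tl : t <= l s by rewrite leNgt; apply/negP => lt; apply: nOt; exact: lO.
    by move: ts; rewrite !ltr_norml => /andP[]; lra.
  have [sr nOr rO] := rP s; rewrite flr; apply: pf.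
  have rt : r s <= t by rewrite leNgt; apply/negP => tr; apply: nOt;
    apply: rO => //; exact: ltW.
  by move: ts; rewrite !ltr_norml => /andP[]; lra.
- by rewrite /= l_id //; apply: nO; left.
- by rewrite /= l_id //; apply: nO; right.
- by move=> t; exists (l t).
move=> s u t s0 su ut t1 /= fst.
have [ls nOa lO] := lP s; have [tr nOb rO] := rP t.
rewrite (flr t) in fst; move: ls nOa lO tr nOb rO fst; set a := l s; set b := r t.
move=> ls nOa lO tr nOb rO fab.
have a0 : 0 <= a by rewrite leNgt; apply/negP => a0; apply: (nO 0); [left|exact: lO].
have b1 : b <= 1 by rewrite leNgt; apply/negP => b1; apply: (nO 1); [right|exact: rO].
(* Otherwise, as [f a = f b], the interval from [a] to [b] could be added to [O], against
   maximality. *)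
have abO v : a < v < b -> O v.
  move=> vab; apply: contrapT => nOv; apply: (Omax (O `|` `]a, b[)).
    split; first exact: subsetUl.
    by move/(_ v); apply: contra_not nOv; apply; right; rewrite /= in_itv.
  split.
  - by apply: openU => //; exact: interval_open.
  - move=> x [/O01 //|]; rewrite /= !in_itv /= => /andP[ax xb].
    by rewrite (le_lt_trans a0) //= (lt_le_trans xb).
  move=> x y xy nx ny xyO; have [nOx nOy] : ~ O x /\ ~ O y.
    by split=> ?; [apply: nx|apply: ny]; left.
  (* A gap of the enlarged set that meets []a, b[] equals it, because [a] and [b] remain outside;
     any other gap is a gap of [O]. *)
  have [[w [/andP[xw wy] /andP[aw wb]]]|disj] :=
    pselect (exists w, x < w < y /\ a < w < b).
    have xa : x <= a.
      rewrite leNgt; apply/negP => ax; apply: nx; right; rewrite /= in_itv /= ax.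
      exact: lt_trans xw wb.
    have yb : b <= y.
      rewrite leNgt; apply/negP => yb; apply: ny; right;
        rewrite /= in_itv /= yb andbT.
      exact: lt_trans aw wy.
    have -> : x = a.
      apply: contrapT => /eqP xa'; have [|//|] := xyO a.
        by rewrite lt_neqAle xa' xa; exact: lt_trans aw wy.
      by rewrite /= in_itv /= ltxx.
    have -> // : y = b.
    apply: contrapT => /eqP; rewrite eq_sym => yb'; have [|//|] := xyO b.
      by rewrite (lt_trans xw wb) /= lt_neqAle yb' yb.
    by rewrite /= in_itv /= ltxx andbF.
  apply: Oloop => // w xwy; have [//|] := xyO w xwy.
  by rewrite /= in_itv /= => awb; case: disj; exists w.
have [-> //|/eqP ua] := eqVneq u a; first by rewrite l_id.
have [->|/eqP ub] := eqVneq u b; first by rewrite l_id.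
congr (f _); apply: l_uniq => //; first exact: le_trans su.
move=> v av vu; apply: abO; rewrite av /= (le_lt_trans vu) // lt_neqAle.
by rewrite (le_trans ut tr) andbT; apply/eqP.
Qed.

End LoopErasure.

(** A continuous map from a compact set to a Hausdorff space is a quotient map onto its image.
    Points of [A] in the fiber of [q a] are handled by continuity of [h \o q]; near the others, [q]
    stays away from [q a] by the Hausdorff property. *)
Lemma within_continuous_quotient (S T Z : topologicalType) (A : set S)
    (q : S -> T) (h : T -> Z) : hausdorff_space T -> compact A ->
  {within A, continuous q} -> {within A, continuous (h \o q)} ->
  {within q @` A, continuous h}.
Proof.
move=> hT cA /subspace_continuousP cq /subspace_continuousP chq.
apply/subspace_continuousP => _ [a Aa <-] U hU.
have /near_covering_withinP nA := (compact_near_coveringP A).1 cA.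
have : \forall y \near q a, A `<=` (fun x => q x = y -> U (h y)).
  apply: (nA T (nbhs (q a)) (fun y x => q x = y -> U (h y))) => x Ax.
  have [qxa|qxa] := pselect (q x = q a).
    have xU : within A (nbhs x) ((h \o q) @^-1` U) by apply: (chq x Ax U);
      rewrite /from_subspace /= qxa.
    exists ([set z | A z -> U (h (q z))], setT); first by split => //; exact: filterT.
    by move=> [z y] [/= zU _] Az <-; exact: zU.
  move: (hT); rewrite open_hausdorff => /(_ _ _ (introN eqP qxa)) [[N M] [/= Nq Mq]].
  move=> [oN oM NM].
  have xN : within A (nbhs x) (q @^-1` N).
    apply: cq => //; apply: open_nbhs_nbhs; split => //; exact: set_mem.
  exists ([set z | A z -> N (q z)], M).
    split => //; apply: open_nbhs_nbhs; split => //; exact: set_mem.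
  move=> [z y] [/= zN My] Az qzy.
  have : (N `&` M) y by split => //; rewrite -qzy; exact: zN.
  by rewrite (eqP NM).
apply: filterS => y AU [x Ax qxy]; exact: AU qxy.
Qed.

Lemma clamp_dist (R : realFieldType) (a b s t : R) : a <= b ->
  `|Num.max a (Num.min b t) - Num.max a (Num.min b s)| <= `|t - s|.
Proof.
move=> ab.
have /andP[h1 h2] : - `|t - s| <= t - s <= `|t - s| by rewrite -ler_norml.
have [bt|tb] := leP b t; have [bs|sb] := leP b s.
- by rewrite subrr normr0.
- by have [as_|sa] := leP a s; rewrite max_r // ler_norml; apply/andP; split; lra.
- by have [at_|ta] := leP a t; rewrite [Num.max a b]max_r // ler_norml;
    apply/andP; split; lra.
- by have [at_|ta] := leP a t; have [as_|sa] := leP a s; rewrite ler_norml;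
    apply/andP; split; lra.
Qed.

(** Extends a path by constants beyond its ends, turning continuity on a subspace into plain
    continuity. *)
Lemma continuous_clamp (R : realType) (T : topologicalType) (f : R -> T) (a b : R) :
  a <= b -> {within `[a, b], continuous f} ->
  continuous (fun t : R => f (Num.max a (Num.min b t))).
Proof.
move=> ab /subspace_continuousP cf t U fU.
have ct : a <= Num.max a (Num.min b t) <= b.
  by rewrite le_max lexx ge_max ab ge_min lexx.
have : within `[a, b] (nbhs (Num.max a (Num.min b t))) (f @^-1` U).
  by apply: cf; rewrite //= in_itv.
rewrite /within /= => /nbhs_ballP[e /= e0 eU].
apply/nbhs_ballP; exists e => // s; rewrite /ball /= => ts.
apply: eU; last by rewrite in_itv /= le_max lexx ge_max ab ge_min lexx.
apply: le_lt_trans ts; rewrite /ball /=.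
exact: clamp_dist.
Qed.

(** * Making a path with interval fibers injective *)

Section Reparametrization.
Context {R : realType} {X : topologicalType} {d : X -> X -> R}.
Hypothesis d_metric : bounded_metric d.

(* The weighted sum [level g] of the functions [spread g u], u rational, is
   continuous and nondecreasing, and it has the same fibers as [g] when those
   are intervals: reparametrizing [g] by [level g] yields an injective path. *)
Definition spread (g : R -> X) (u t : R) : R :=
  sup [set d (g u) (g s) | s in [set s | s = u \/ u <= s <= t]].

Lemma spread_ge (g : R -> X) u t s : u <= s <= t -> d (g u) (g s) <= spread g u t.
Proof.
move=> ust; apply: ub_le_sup; last by exists s => //; right.
by exists 1 => _ [v _ <-]; exact: bounded_metric_le1.
Qed.

Lemma spread_le (g : R -> X) u t c : 0 <= c ->
  (forall s, u <= s <= t -> d (g u) (g s) <= c) -> spread g u t <= c.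
Proof.
move=> c0 gc; apply: ge_sup.
  by exists (d (g u) (g u)), u => //; left.
by move=> _ [s [->|ust] <-]; [rewrite (bounded_metricxx d_metric)|exact: gc].
Qed.

Lemma spread_ge0 (g : R -> X) u t : 0 <= spread g u t.
Proof.
apply: ub_le_sup; last by exists u; [left|rewrite (bounded_metricxx d_metric)].
by exists 1 => _ [v _ <-]; exact: bounded_metric_le1.
Qed.

Lemma spread_le1 (g : R -> X) u t : spread g u t <= 1.
Proof. by apply: spread_le => // s _; exact: bounded_metric_le1. Qed.

Lemma spread_mono (g : R -> X) u s t : s <= t -> spread g u s <= spread g u t.
Proof.
move=> st; apply: spread_le => [|v /andP[uv vs]]; first exact: spread_ge0.
by apply: spread_ge; rewrite uv (le_trans vs).
Qed.

Definition nth_rat (k : nat) : R :=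
  if unpickle k is Some r then ratr (r : rat) else 0.

Definition wsum (g : R -> X) (n : nat) (t : R) : R :=
  \sum_(k < n) 2^-1 ^+ k.+1 * spread g (nth_rat k) t.

Definition level (g : R -> X) (t : R) : R := sup [set wsum g n t | n in [set: nat]].

Lemma sum_half n : \sum_(k < n) 2^-1 ^+ k.+1 <= 1 :> R.
Proof.
have -> : \sum_(k < n) 2^-1 ^+ k.+1 = 1 - 2^-1 ^+ n :> R.
  elim: n => [|n IHn]; first by rewrite big_ord0 expr0 subrr.
  by rewrite big_ord_recr /= IHn exprS; lra.
by rewrite gerBl exprn_ge0.
Qed.

Lemma wsum_leD (g : R -> X) s t e n : 0 <= e ->
  (forall u, spread g u t <= spread g u s + e) -> wsum g n t <= wsum g n s + e.
Proof.
move=> e0 ge; rewrite -[e in leRHS]mul1r.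
apply: (@le_trans _ _ (wsum g n s + (\sum_(k < n) 2^-1 ^+ k.+1) * e)); last first.
  by rewrite lerD2l ler_wpM2r // sum_half.
rewrite mulr_suml -big_split; apply: ler_sum => k _ /=.
by rewrite -mulrDr ler_wpM2l // exprn_ge0.
Qed.

Lemma wsum_ub (g : R -> X) t : has_ubound [set wsum g n t | n in [set: nat]].
Proof.
exists 1 => _ [n _ <-]; apply: le_trans (sum_half n); apply: ler_sum => k _.
by rewrite ler_piMr ?exprn_ge0 // spread_le1.
Qed.

Lemma wsum_level (g : R -> X) n t : wsum g n t <= level g t.
Proof. by apply: ub_le_sup; [exact: wsum_ub|exists n]. Qed.

Lemma level_le (g : R -> X) t c : (forall n, wsum g n t <= c) -> level g t <= c.
Proof. by move=> gc; apply: ge_sup; [exists (wsum g 0 t), 0%N|move=> _ [n _ <-]]. Qed.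

(** The weights sum to at most [1], so a bound on the growth of each spread, uniform in [u], bounds
    the growth of the level. Monotonicity and constancy on fibers use it with [e = 0]. *)
Lemma level_leD (g : R -> X) s t e : 0 <= e ->
  (forall u, spread g u t <= spread g u s + e) -> level g t <= level g s + e.
Proof.
move=> e0 ge; apply: level_le => n; apply: le_trans (wsum_leD n e0 ge) _.
by rewrite lerD2r wsum_level.
Qed.

Lemma level_mono (g : R -> X) s t : s <= t -> level g s <= level g t.
Proof. by move=> st; rewrite -[leRHS]addr0; apply: level_leD => // u;
  rewrite addr0 spread_mono. Qed.

Lemma level_lt (g : R -> X) k s t : s <= t ->
  spread g (nth_rat k) s < spread g (nth_rat k) t -> level g s < level g t.
Proof.
move=> st; rewrite -subr_gt0; set c := _ - _ => c0.
have w0 : (0 : R) < 2^-1 ^+ k.+1 by rewrite exprn_gt0 // invr_gt0.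
have wc : 0 < 2^-1 ^+ k.+1 * c by rewrite mulr_gt0.
have wS m n : (m <= n)%N -> wsum g m s <= wsum g n s.
  move=> mn; rewrite /wsum -!(big_mkord xpredT (fun k =>
    2^-1 ^+ k.+1 * spread g (nth_rat k) s)).
  rewrite [leRHS](big_cat_nat (n := m)) //= lerDl sumr_ge0 // => i _.
  by rewrite mulr_ge0 ?exprn_ge0 // spread_ge0.
apply: (@le_lt_trans _ _ (level g t - 2^-1 ^+ k.+1 * c));
  last by rewrite ltrBlDr ltrDl.
(* Partial sums are prolonged beyond index [k], so that the term that grows is present. *)
apply: level_le => n; apply: le_trans (wS _ _ (leq_maxl n k.+1)) _.
set m := maxn n k.+1; have km : (k < m)%N by rewrite /m leq_maxr.
rewrite lerBrDr; apply: le_trans (wsum_level g m t).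
rewrite /wsum (bigD1 (Ordinal km)) //= [leRHS](bigD1 (Ordinal km)) //=.
rewrite addrAC -mulrDr /c (addrC (spread g (nth_rat k) s)) subrK.
by rewrite lerD2l; apply: ler_sum => i _; rewrite ler_wpM2l ?exprn_ge0 // spread_mono.
Qed.

Lemma level_eq (g : R -> X) s t : s <= t ->
  (forall u, s <= u -> u <= t -> g u = g s) -> level g s = level g t.
Proof.
move=> st gst; apply/eqP; rewrite eq_le level_mono //= -[leRHS]addr0.
apply: level_leD => // u; rewrite addr0; apply: spread_le => [|v /andP[uv vt]].
  exact: spread_ge0.
have [vs|/ltW sv] := leP v s; first by apply: spread_ge; rewrite uv.
rewrite (gst v) //; have [us|/ltW su] := leP u s.
  by apply: spread_ge; rewrite us lexx.
by rewrite (gst u su (le_trans uv vt)) (bounded_metricxx d_metric) spread_ge0.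
Qed.

(** Near [t] the path stays within [e / 2] of [g t], so between two nearby times every spread grows
    by at most [e], whatever its base point. *)
Lemma level_continuous (g : R -> X) : continuous g -> continuous (level g).
Proof.
move=> /(bounded_metric_continuousP d_metric) cg t.
apply/cvgrPdist_le => /= e e0; have e20 : 0 < e / 2 by rewrite divr_gt0.
have [r r0 gr] := cg t _ e20.
have near s s' : s <= s' -> `|t - s| < r -> `|t - s'| < r -> level g s' <=
  level g s + e.
  move=> ss' ts ts'; apply: level_leD => [|u]; first exact: ltW.
  have sr v : s <= v -> v <= s' -> d (g t) (g v) < e / 2.
    by move=> sv vs'; apply: gr; move: ts ts';
      rewrite !ltr_norml => /andP[? ?] /andP[? ?]; apply/andP; lra.
  apply: spread_le => [|v /andP[uv vs']].
    by rewrite addr_ge0 ?spread_ge0 // ltW.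
  have [vs|/ltW sv] := leP v s.
    by apply: le_trans (spread_ge _ (_ : u <= v <= s)) _; rewrite ?uv // lerDl ltW.
  have [us|/ltW su] := leP u s.
    have := spread_ge g (_ : u <= s <= s); rewrite us lexx => /(_ isT).
    have := bounded_metric_triangle d_metric (g s) (g u) (g v).
    have := bounded_metric_triangle d_metric (g t) (g s) (g v).
    have := sr s (lexx _) ss'; have := sr v sv vs'.
    by rewrite (bounded_metric_sym d_metric (g s) (g t)); lra.
  have := sr u su (le_trans uv vs'); have := sr v sv vs'; have := spread_ge0 g u s.
  have := bounded_metric_triangle d_metric (g t) (g u) (g v).
  by rewrite (bounded_metric_sym d_metric (g u) (g t)); lra.
apply/nbhs_ballP; exists r => // s; rewrite /ball /= => ts.
have tt : `|t - t| < r by rewrite subrr normr0.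
rewrite ler_norml; have [st|/ltW ts'] := leP s t.
  have := near _ _ st ts tt; have := level_mono g st; move=> ? ?; apply/andP; lra.
have := near _ _ ts' tt ts; have := level_mono g ts'; move=> ? ?; apply/andP; lra.
Qed.

(** If [g s] and [g t] differ, a rational [q] slightly after [s] has [g q] closer to [g s] than
    [g t] is, hence different from [g t]. The spread from [q] vanishes at [s], which precedes [q],
    and is positive at [t]. *)
Lemma level_inj (g : R -> X) s t : continuous g -> 
  0 <= s -> s <= t -> t <= 1 ->
  (forall s u t, 0 <= s -> s <= u -> u <= t -> t <= 1 -> g s = g t -> g u = g s) ->
  (level g s = level g t <-> g s = g t).
Proof.
move=> /(bounded_metric_continuousP d_metric) cg s0 st t1 gint; split; last first.
  by move=> gst; apply: level_eq => // u su ut; exact: (gint s u t).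
move=> lst; apply: contrapT => gst.
have e0 := bounded_metric_gt0 d_metric gst.
have [r r0 gr] := cg s _ e0.
have slt : s < t by rewrite lt_neqAle st andbT; apply/eqP => e; apply: gst; rewrite e.
have [|q] := @rat_in_itvoo _ s (Num.min t (s + r)).
  by rewrite lt_min slt ltrDl.
rewrite in_itv /= lt_min => /and3P[sq qt qr].
have gqt : g (ratr q) <> g t.
  move=> gqt; have : d (g s) (g (ratr q)) < d (g s) (g t).
    by apply: gr; rewrite distrC ger0_norm; lra.
  by rewrite gqt ltxx.
have : level g s < level g t.
  apply: (@level_lt _ (pickle q)) => //; rewrite /nth_rat pickleK.
  apply: (@le_lt_trans _ _ 0).
    by apply: spread_le => // v /andP[qv vs]; lra.
  apply: lt_le_trans (spread_ge _ (_ : ratr q <= t <= t)).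
    exact: bounded_metric_gt0.
  by rewrite lexx (ltW qt).
by rewrite lst ltxx.
Qed.

(** [tau] is a section of the normalized level [p]. As [p] and [g] have the same fibers on [[0, 1]],
    [g \o tau] is the map that [g] induces on the quotient by [p]: it is injective, and continuous
    by [within_continuous_quotient]. *)
Lemma monotone_path_arc (g : R -> X) : continuous g -> g 0 <> g 1 ->
  (forall s u t, 0 <= s -> s <= u -> u <= t -> t <= 1 -> g s = g t -> g u = g s) ->
  exists h : R -> X, [/\ continuous h, h 0 = g 0, h 1 = g 1,
    set_inj `[0, 1] h & forall t, exists s, h t = g s].
Proof.
move=> cg g01 gint; pose l := level g.
have linj s t : 0 <= s <= 1 -> 0 <= t <= 1 -> l s = l t <-> g s = g t.
  move=> /andP[s0 s1] /andP[t0 t1]; have [st|/ltW ts] := leP s t.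
    exact: level_inj.
  by have := level_inj cg t0 ts s1 gint; rewrite -/l; split=> /esym /H /esym.
have l01 : l 0 < l 1.
  rewrite lt_neqAle level_mono // andbT; apply/eqP => /linj; rewrite !lexx !ler01.
  by move=> /(_ isT isT).
pose p t := (l t - l 0) / (l 1 - l 0).
have lB : 0 < l 1 - l 0 by rewrite subr_gt0.
have cl : continuous l by exact: level_continuous.
have cp : continuous p.
  move=> t; apply: cvgM; last exact: cvg_cst.
  by apply: cvgB; [exact: cl|exact: cvg_cst].
have p01 t : 0 <= t <= 1 -> 0 <= p t <= 1.
  move=> /andP[t0 t1]; apply/andP; split.
    by rewrite divr_ge0 ?(ltW lB) // subr_ge0 level_mono.
  by rewrite ler_pdivrMr // mul1r lerD2r level_mono.
have psurj v : exists t, 0 <= v <= 1 -> 0 <= t <= 1 /\ p t = v.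
  have [v01|nv01] := pselect (is_true (0 <= v <= 1)); last by exists 0.
  have [|||t] := @IVT R p 0 1 v.
  - exact: ler01.
  - by apply: continuous_subspaceT.
  - by rewrite /p subrr mul0r divff ?gt_eqF // min_l ?max_r.
  by rewrite in_itv /= => t01 ptv; exists t.
have /choice[tau tauP] := psurj.
have hp t : 0 <= t <= 1 -> g (tau (p t)) = g t.
  move=> t01; have [t01' /(congr1 (fun x => x * (l 1 - l 0)))] := tauP _ (p01 _ t01).
  by rewrite !divfK ?gt_eqF // => /addIr /linj; apply.
have ch : {within `[0, 1], continuous (g \o tau)}.
  have -> : `[0, 1]%classic = p @` `[0, 1].
    apply/seteqP; split=> v; rewrite /= in_itv /=.
      by move=> /tauP[t01 <-]; exists (tau v); rewrite //= in_itv.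
    by move=> [t] /[swap] <-; rewrite in_itv /=; exact: p01.
  apply: within_continuous_quotient.
  - exact: Rhausdorff.
  - exact: segment_compact.
  - exact: continuous_subspaceT.
  - apply: (@subspace_eq_continuous _ _ _ g); last exact: continuous_subspaceT.
    by move=> t; rewrite inE /= in_itv /= => t01; rewrite /from_subspace /= hp.
have p0 : p 0 = 0 by rewrite /p subrr mul0r.
have p1 : p 1 = 1 by rewrite /p divff ?gt_eqF.
exists (fun t => (g \o tau) (Num.max 0 (Num.min 1 t))); split.
- exact: continuous_clamp.
- by rewrite min_r ?max_l //= -{1}p0 hp // lexx ler01.
- by rewrite min_l ?max_r //= -{1}p1 hp // lexx ler01.
- move=> s t; rewrite !inE /= !in_itv /= => s01 t01.
  have cl01 v : 0 <= v <= 1 -> Num.max 0 (Num.min 1 v) = v.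
    by move=> /andP[v0 v1]; rewrite min_r // max_r.
  rewrite !cl01 //; have [ts <-] := tauP s s01; have [tt <-] := tauP t t01.
  by rewrite !hp // => /linj; rewrite /p => ->.
- by move=> t; exists (tau (Num.max 0 (Num.min 1 t))).
Qed.

Definition arc_in (U : set X) (p q : X) : Prop :=
  exists h : R -> X, [/\ continuous h, h 0 = p, h 1 = q,
    set_inj `[0, 1] h & forall t, U (h t)].

Lemma path_arc (U : set X) p q : path_in (R := R) U p q -> p <> q -> arc_in U p q.
Proof.
move=> [f [cf f0 f1 fU]] pq; have [g [cg g0 g1 gf gint]] := loop_erasure d_metric cf.
have [|h [ch h0 h1 hinj hg]] := monotone_path_arc cg _ gint.
  by rewrite g0 g1 f0 f1.
exists h; split => //; [by rewrite h0 g0|by rewrite h1 g1|].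
by move=> t; have [s ->] := hg t; have [v ->] := gf s.
Qed.

End Reparametrization.

(** * Simple closed curves *)

Lemma compact_homeomorphism_on (S T : topologicalType) (A : set S) (f : S -> T) :
  hausdorff_space T -> A !=set0 -> compact A -> {within A, continuous f} ->
  set_inj A f -> homeomorphism_on A (f @` A) f.
Proof.
move=> hT [a Aa] cA cf finj; split; [exact: inj_bij|by []|].
have /choice[g gP] : forall y, exists x, (f @` A) y -> A x /\ f x = y.
  move=> y; have [[x Ax fxy]|nfy] := pselect ((f @` A) y); first by exists x.
  by exists a.
have gK x : A x -> g (f x) = x.
  move=> Ax; have [|Ag fg] := gP (f x); first by exists x.
  by apply: finj => //; exact: mem_set.
exists g; last by move=> x; rewrite inE => /gK.
(* Here the quotient map is [f] itself, and [g \o f] is the identity on [A]. *)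
apply: within_continuous_quotient => //.
apply: (@subspace_eq_continuous _ A S (fun x => x)).
  by move=> x; rewrite inE => Ax; rewrite /from_subspace /= gK.
by apply: continuous_subspaceT => x; exact: cvg_id.
Qed.

Lemma sqr_le1_itv (R : realType) (x : R) : x ^+ 2 <= 1 -> -1 <= x <= 1.
Proof. by move=> ?; apply/andP; split; nra. Qed.

Lemma circle_compact (R : realType) : compact (@circle R).
Proof.
apply: (@subclosed_compact _ (@circle R) (`[-1, 1] `*` `[-1, 1])).
- have -> : @circle R = (fun p : R * R => p.1 ^+ 2 + p.2 ^+ 2) @^-1` [set 1] by [].
  apply: preimage_closed => [p _|]; last exact: closed_eq.
  apply: cvgD; apply: cvgM;
    [exact: cvg_fst|exact: cvg_fst|exact: cvg_snd|exact: cvg_snd].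
- by apply: compact_setX; exact: segment_compact.
- move=> [x y] /= xy; have := sqr_ge0 x; have := sqr_ge0 y => y0 x0.
  by split; rewrite /= in_itv /=; apply: sqr_le1_itv; move: xy;
    rewrite /circle /=; lra.
Qed.

(** The closed upper half of the circle is sent through [f] of the first coordinate, the open lower
    half through [g]. The two formulas agree where the halves meet, at first coordinate [-1] or
    [1]. *)
Lemma arcs_simple_closed_curve (R : realType) (X : topologicalType) (f g : R -> X) :
  hausdorff_space X -> continuous f -> continuous g ->
  set_inj `[-1, 1] f -> set_inj `[-1, 1] g -> f (-1) = g (-1) -> f 1 = g 1 ->
  (forall s t, -1 <= s <= 1 -> -1 <= t <= 1 -> f s = g t -> s = t /\ s ^+ 2 = 1) ->
  exists C : set X, simple_closed_curve R C.
Proof.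
move=> hX cf cg finj ginj fgm fg1 fg.
pose F (p : R * R) := if 0 <= p.2 then f p.1 else g p.1.
have p1 p : @circle R p -> -1 <= p.1 <= 1.
  move=> pc; have p20 := sqr_ge0 p.2; apply: sqr_le1_itv.
  by move: pc; rewrite /circle /=; lra.
exists (F @` @circle R), F; apply: compact_homeomorphism_on => //.
- by exists (1, 0); rewrite /circle /= expr1n expr0n addr0.
- exact: circle_compact.
- apply/subspace_continuousP => p pc U FU.
  have c1 : (fun q : R * R => q.1) @ p --> p.1 by exact: cvg_fst.
  have c2 : (fun q : R * R => q.2) @ p --> p.2 by exact: cvg_snd.
  have cfp : nbhs (f p.1) U -> nbhs p [set q | U (f q.1)].
    by move=> fU; exact: (cvg_comp _ _ c1 (cf p.1) U fU).
  have cgp : nbhs (g p.1) U -> nbhs p [set q | U (g q.1)].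
    by move=> gU; exact: (cvg_comp _ _ c1 (cg p.1) U gU).
  have oU (D : set R) : open D -> D p.2 -> nbhs p [set q : R * R | D q.2].
    by move=> oD Dp; apply: (c2 D); exact: open_nbhs_nbhs.
  suff : nbhs p [set q | circle q -> U (F q)] by [].
  move: FU; rewrite /from_subspace /F; case: (ltgtP 0 p.2) => [p2|p2|p2] FU.
  + have n2 : nbhs p [set q : R * R | 0 < q.2] :=
      oU [set x | 0 < x] (@open_gt R 0) p2.
    apply: filterS2 (cfp FU) n2 => q /= qU q2 _.
    by rewrite ltW.
  + have n2 : nbhs p [set q : R * R | q.2 < 0] :=
      oU [set x | x < 0] (@open_lt R 0) p2.
    apply: filterS2 (cgp FU) n2 => q /= qU q2 _.
    by rewrite leNgt q2.
  + have gU : nbhs (g p.1) U.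
      suff <- : f p.1 = g p.1 by [].
      move: pc; rewrite /circle /= -p2 expr0n /= addr0 => /eqP.
      by rewrite sqrf_eq1 => /orP[] /eqP ->.
    by apply: filterS2 (cfp FU) (cgp gU) => q /= qfU qgU _; case: ifP.
- have mem (x : R) : -1 <= x <= 1 -> x \in [set` `[-1, 1]] by rewrite inE /= in_itv.
  move=> p q; rewrite !inE => pc qc; rewrite /F.
  have pq1 : p.1 = q.1 -> p.2 ^+ 2 = q.2 ^+ 2.
    by move=> e; move: pc qc; rewrite /circle /= e; lra.
  have fin : p.1 = q.1 -> 0 <= p.2 * q.2 -> p = q.
    move=> e1 pq; rewrite [p]surjective_pairing [q]surjective_pairing e1; congr pair.
    have /eqP := pq1 e1; rewrite eqf_sqr => /orP[/eqP //|/eqP e].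
    move: pq; rewrite e mulNr oppr_ge0 -expr2 => q2.
    have : q.2 ^+ 2 == 0 by rewrite eq_le q2 sqr_ge0.
    by rewrite sqrf_eq0 => /eqP ->; rewrite oppr0.
  case: leP => p2; case: leP => q2.
  + move=> /finj e; apply: fin; last exact: mulr_ge0.
    by apply: e; apply: mem; exact: p1.
  (* A common value forces first coordinate [-1] or [1], hence second coordinate [0] on the circle,
     against [q.2 < 0]. *)
  + move=> e; have [e1 s1] := fg _ _ (p1 _ pc) (p1 _ qc) e.
    by exfalso; move: qc; rewrite /circle /= -e1 s1; nra.
  + move=> e; have [e1 s1] := fg _ _ (p1 _ qc) (p1 _ pc) (esym e).
    by exfalso; move: pc; rewrite /circle /= -e1 s1; nra.
  + move=> /ginj e; apply: fin; last by nra.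
    by apply: e; apply: mem; exact: p1.
Qed.

(* If [f s] avoids [g], the subarc of [f] around [f s] that is cut out by [g]
   and the part of [g] between its endpoints form a circle. *)
Lemma distinct_arcs_curve (R : realType) (X : topologicalType) (f g : R -> X) s :
  hausdorff_space X -> continuous f -> continuous g ->
  set_inj `[0, 1] f -> set_inj `[0, 1] g -> f 0 = g 0 -> f 1 = g 1 ->
  0 <= s <= 1 -> (forall t, 0 <= t <= 1 -> f s <> g t) ->
  exists C : set X, simple_closed_curve R C.
Proof.
move=> hX cf cg finj ginj fg0 fg1 /andP[s0 s1] fgs.
have injf u v : 0 <= u <= 1 -> 0 <= v <= 1 -> f u = f v -> u = v.
  by move=> u01 v01; apply: finj; rewrite inE /= in_itv.
have injg u v : 0 <= u <= 1 -> 0 <= v <= 1 -> g u = g v -> u = v.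
  by move=> u01 v01; apply: ginj; rewrite inE /= in_itv.
pose W a b := [set t | ~ (f @` `[a, b]) (g t)].
have oW a b : open (W a b).
  apply: (@open_comp _ _ g (~` (f @` `[a, b]))) => [t _|]; first exact: cg.
  apply: closed_openC; apply: compact_closed => //.
  by apply: continuous_compact; [exact: continuous_subspaceT|exact: segment_compact].
(* [t1] is the last time at which [g] meets [f] over [[0, s]], and [t2] the first time from [t1] on
   at which it meets [f] over [[s, 1]]; strictly between them [g] misses [f]. *)
have [||t1 [t10 t11 nW1 aft1]] := @last_before _ (W 0 s) 1 0 (oW _ _).
- exact: ler01.
- by apply; exists 0 => //; rewrite /= in_itv /= lexx s0.
have [||t2 [t12 t21 nW2 bef2]] := @first_after _ (W s 1) t1 1 (oW _ _).
- by [].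
- by apply; exists 1 => //; rewrite /= in_itv /= lexx s1.
move/contrapT: nW1 => [a]; rewrite /= in_itv /= => /andP[a0 as_] fa.
move/contrapT: nW2 => [b]; rewrite /= in_itv /= => /andP[sb b1] fb.
have t101 : 0 <= t1 <= 1 by rewrite t10.
have t201 : 0 <= t2 <= 1 by rewrite (le_trans t10).
have {}as_ : a < s by rewrite lt_neqAle as_ andbT; apply/eqP => e;
  apply: (fgs t1); rewrite // -e.
have {}sb : s < b by rewrite lt_neqAle sb andbT; apply/eqP => e;
  apply: (fgs t2); rewrite // e.
have ab := lt_trans as_ sb.
have {}t12 : t1 < t2.
  rewrite lt_neqAle t12 andbT; apply/eqP => e; have := ab;
    rewrite (injf a b) ?ltxx //.
  - by rewrite a0 (le_trans (ltW ab)).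
  - by rewrite b1 (le_trans a0 (ltW ab)).
  - by rewrite fa fb e.
pose scale c e (x : R) := (e - c) / 2 * x + (e + c) / 2.
have scale_itv c e x : c < e -> -1 <= x <= 1 -> c <= scale c e x <= e.
  move=> ce /andP[x1 x2]; rewrite /scale; apply/andP; split; nra.
have scale_inj c e x y : c < e -> scale c e x = scale c e y -> x = y.
  by move=> ce /addIr /mulfI; apply; rewrite mulf_neq0 ?invr_eq0 // subr_eq0 gt_eqF.
have scale1 c e : scale c e 1 = e by rewrite /scale; lra.
have scaleN1 c e : scale c e (-1) = c by rewrite /scale; lra.
have itvab x : a <= x <= b -> 0 <= x <= 1.
  by move=> /andP[ax xb]; rewrite (le_trans a0 ax) (le_trans xb b1).
have itvt x : t1 <= x <= t2 -> 0 <= x <= 1.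
  by move=> /andP[tx xt]; rewrite (le_trans t10 tx) (le_trans xt t21).
apply: (@arcs_simple_closed_curve _ _ (f \o scale a b) (g \o scale t1 t2) hX).
- exact: continuous_affine cf.
- exact: continuous_affine cg.
- move=> x y; rewrite !inE /= !in_itv /= => x1 y1 /injf e.
  by apply: (@scale_inj a b) => //; apply: e; apply: itvab; exact: scale_itv.
- move=> x y; rewrite !inE /= !in_itv /= => x1 y1 /injg e.
  by apply: (@scale_inj t1 t2) => //; apply: e; apply: itvt; exact: scale_itv.
- by rewrite /= !scaleN1.
- by rewrite /= !scale1.
move=> x y x1 y1 /=; set u := scale a b x; set v := scale t1 t2 y => fgu.
have u_itv : a <= u <= b by exact: scale_itv.
have v_itv : t1 <= v <= t2 by exact: scale_itv.
have a01 : 0 <= a <= 1 by apply: itvab; rewrite lexx ltW.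
have b01 : 0 <= b <= 1 by apply: itvab; rewrite lexx ltW.
have [vt1|vt1] := eqVneq v t1.
  have ua : u = a by apply: injf => //; [exact: itvab|rewrite fa fgu vt1].
  have -> : x = -1 by apply: (@scale_inj a b) => //; rewrite scaleN1.
  have -> : y = -1 by apply: (@scale_inj t1 t2) => //; rewrite scaleN1.
  by rewrite sqrrN expr1n.
have [vt2|vt2] := eqVneq v t2.
  have ub : u = b by apply: injf => //; [exact: itvab|rewrite fb fgu vt2].
  have -> : x = 1 by apply: (@scale_inj a b) => //; rewrite scale1.
  have -> : y = 1 by apply: (@scale_inj t1 t2) => //; rewrite scale1.
  by rewrite expr1n.
move: v_itv => /andP[t1v vt]; have /andP[u0 u1] := itvab _ u_itv.
have [us|/ltW su] := leP u s.
  have [] : W 0 s v.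
    by apply: aft1; [rewrite lt_neqAle eq_sym vt1|exact: le_trans vt t21].
  by exists u => //; rewrite /= in_itv /= u0.
have [] : W s 1 v by apply: bef2 => //; rewrite lt_neqAle vt2.
by exists u => //; rewrite /= in_itv /= su.
Qed.

(** * Branch points and arcs of dendrites *)

Section LocallyConnected.
Variable X : topologicalType.
Hypotheses (X_hausdorff : hausdorff_space X) (X_lc : locally_connected X).

Lemma open_compl1 (z : X) : open (~` [set z]).
Proof. exact/closed_openC/accessible_closed_set1/hausdorff_accessible. Qed.

Lemma component_open (z a : X) : open (component z a).
Proof.
rewrite openE => y ay; have zy := connected_component_sub ay.
have [V [oV Vy cV Vz]] := X_lc (open_nbhs_nbhs (conj (open_compl1 z) zy)).
apply: (@filterS _ _ _ V); last exact: open_nbhs_nbhs.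
move=> w Vw; apply: connected_component_trans ay _.
exact: connected_component_max Vz cV _ Vw.
Qed.

(** Otherwise the component, open by local connectedness, would also be closed, hence the whole
    space, [z] included. *)
Lemma component_closure (z a : X) : connected [set: X] -> a <> z ->
  closure (component z a) z.
Proof.
move=> cX az; apply: contrapT => nz.
have aa : component z a a by exact: connected_component_refl.
have aK : component z a = closure (component z a).
  apply/seteqP; split; first exact: subset_closure.
  apply: connected_component_max.
  - exact: subset_closure.
  - by move=> w wK /= wz; apply: nz; rewrite wz in wK.
  - exact/connected_closure/component_connected.
have : component z a z.
  rewrite (cX (component z a)) //; first by exists a.
  - by exists (component z a); [exact: component_open|rewrite setTI].
  - by exists (component z a); [rewrite aK; exact: closed_closure|rewrite setTI].
by move=> /connected_component_sub; apply.
Qed.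

Lemma component_joined (z z' a b : X) : connected [set: X] -> a <> z -> b <> z ->
  z' <> z -> ~ component z a z' -> ~ component z b z' -> component z' a b.
Proof.
(* The closures of the two components share [z] and avoid [z']. *)
move=> cX az bz z'z naz' nbz'.
have avoid c : ~ component z c z' -> ~ closure (component z c) z'.
  move=> ncz' /(_ (component z z')) []; last first.
    move=> w [cw z'w]; apply: ncz'; apply: connected_component_trans cw _.
    exact: connected_component_sym.
  apply: open_nbhs_nbhs; split; first exact: component_open.
  exact: connected_component_refl.
exists (closure (component z a) `|` closure (component z b)); last first.
  by right; apply: subset_closure; exact: connected_component_refl.
split.
- by left; apply: subset_closure; exact: connected_component_refl.
- by move=> w [] wK /= wz'; rewrite wz' in wK; [apply: (avoid a)|apply: (avoid b)].
- apply: connectedU; last 2 first.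
  + exact/connected_closure/component_connected.
  + exact/connected_closure/component_connected.
  by exists z; split; exact: component_closure.
Qed.

(** A point [z'] other than [z] lies in at most one of the three components at [z], so two of [a],
    [b], [c] are joined through [z] away from [z']. *)
Lemma three_components_inj (z z' a b c : X) : connected [set: X] ->
  [/\ a <> z, b <> z & c <> z] ->
  [/\ ~ component z a b, ~ component z a c & ~ component z b c] ->
  [/\ ~ component z' a b, ~ component z' a c & ~ component z' b c] -> z' = z.
Proof.
move=> cX [az bz cz] [ab ac bc] [ab' ac' bc']; apply: contrapT => z'z.
have [az'|naz'] := pselect (component z a z').
  apply: bc'; apply: (@component_joined z) => // [bz'|cz'].
    by apply: ab; apply: connected_component_trans az' (connected_component_sym bz').
  by apply: ac; apply: connected_component_trans az' (connected_component_sym cz').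
have [bz'|nbz'] := pselect (component z b z'); last first.
  by apply: ab'; exact: (@component_joined z).
apply: ac'; apply: (@component_joined z) => // cz'.
by apply: bc; apply: connected_component_trans bz' (connected_component_sym cz').
Qed.

Lemma Br_three_components (z : X) : Br X z -> exists a b c,
  [/\ a <> z, b <> z & c <> z] /\
  [/\ ~ component z a b, ~ component z a c & ~ component z b c].
Proof.
move=> /card_leP[f].
have fP u : exists2 a, a <> z & component z a = val (f u).
  by have [a az fa] := set_mem (valP (f u)); exists a.
pose u i (i3 : (i < 3)%N) : `I_3 := SigSub (mem_set i3 : i \in `I_3).
have [a az fa] := fP (@u 0%N isT); have [b bz fb] := fP (@u 1%N isT).
have [c cz fc] := fP (@u 2%N isT); exists a, b, c; split => //.
have neq v w x y : v <> w -> component z x = val (f v) ->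
    component z y = val (f w) -> ~ component z x y.
  move=> vw fx fy /same_connected_component.
  rewrite -!/(component z _) fx fy => /val_inj fvw; apply: vw.
  by apply: (@inj _ _ _ f) fvw; rewrite inE.
by split; [apply: neq fa fb|apply: neq fa fc|apply: neq fb fc] => /(congr1 val).
Qed.

End LocallyConnected.

Section Dendrites.
Context {R : realType} {X : topologicalType}.
Hypothesis X_dendrite : dendrite R X.

Let X_compact : compact [set: X]. Proof. by case: X_dendrite => -[]. Qed.
Let X_connected : connected [set: X]. Proof. by case: X_dendrite => -[]. Qed.
Let X_lc : locally_connected X. Proof. by case: X_dendrite. Qed.
Let no_curve (C : set X) : ~ simple_closed_curve R C. Proof. by case: X_dendrite. Qed.
Let X_metric : exists d : X -> X -> R, bounded_metric d.
Proof. by case: X_dendrite => -[_ _ _ /metrizable_bounded_metric]. Qed.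

Lemma dendrite_hausdorff : hausdorff_space X.
Proof. by have [d dP] := X_metric; exact: bounded_metric_hausdorff dP. Qed.

Lemma countable_dense : exists D : nat -> X,
  forall U, open U -> U !=set0 -> exists n, U (D n).
Proof.
have [d dP] := X_metric; have [x0 _] : [set: X] !=set0 by case: X_dendrite => -[].
have /choice[s sP] : forall n, exists s : seq X,
    [set: X] `<=` [set x | exists2 v, v \in s & d v x < n.+1%:R^-1].
  move=> n; apply: (compact_finite_cover X_compact) => x _.
  by apply: bounded_metric_nbhs_lt => //; rewrite invr_gt0.
exists (fun k => if unpickle k is Some ni then nth x0 (s ni.1) ni.2 else x0).
move=> U oU [x Ux]; have /(bounded_metric_nbhs dP)[e e0 eU] : nbhs x U.
  exact: open_nbhs_nbhs.
have [n ne] := invS_lt e0; have [v vs vx] := sP n x I.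
exists (pickle (n, index v (s n))); rewrite pickleK /= nth_index //.
by apply: eU; rewrite (bounded_metric_sym dP); exact: lt_trans vx ne.
Qed.

(** Three components at a branch point are open, so each contains a term of the dense sequence; by
    [three_components_inj] the triple of indices determines the branch point. *)
Lemma countable_Br : countable (Br X).
Proof.
have [D DP] := countable_dense.
have /choice[f fP] : forall z, exists ijk : nat * nat * nat, Br X z ->
    [/\ D ijk.1.1 <> z, D ijk.1.2 <> z & D ijk.2 <> z] /\
    [/\ ~ component z (D ijk.1.1) (D ijk.1.2), ~ component z (D ijk.1.1) (D ijk.2)
      & ~ component z (D ijk.1.2) (D ijk.2)].
  move=> z; have [Bz|nBz] := pselect (Br X z); last by exists (0, 0, 0)%N.
  have [a [b [c [[az bz cz] [ab ac bc]]]]] := Br_three_components Bz.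
  have near x : x <> z -> exists n, component z x (D n).
    move=> xz; apply: DP; first exact: component_open dendrite_hausdorff X_lc _ _.
    by exists x; exact: connected_component_refl.
  have [i ai] := near a az; have [j bj] := near b bz; have [k ck] := near c cz.
  exists (i, j, k) => _ /=; split.
    by split=> e; [move: ai|move: bj|move: ck]; move/connected_component_sub;
      rewrite e; apply.
  have tr x y x' y' : component z x x' -> component z y y' ->
      ~ component z x y -> ~ component z x' y'.
    move=> xx' yy' xy x'y'; apply: xy; apply: connected_component_trans xx' _.
    by apply: connected_component_trans x'y' _; exact: connected_component_sym.
  by split; [exact: tr ab|exact: tr ac|exact: tr bc].
apply/countable_injP; exists (pickle \o f) => x y;
  rewrite !inE => Bx By /= /(pcan_inj pickleK) fxy.
have [xD xc] := fP x Bx; have [_ yc] := fP y By; rewrite -fxy in yc.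
by have -> // := three_components_inj dendrite_hausdorff X_lc X_connected xD xc yc.
Qed.

(** Clamping makes the parametrization continuous on the whole line; conversely, compactness
    supplies the continuous inverse. *)
Lemma joining_arcP (x y : X) (A : set X) : joining_arc R x y A <->
  exists f : R -> X, [/\ continuous f, f 0 = x, f 1 = y, set_inj `[0, 1] f &
    A = f @` `[0, 1]].
Proof.
split=> [[f [[fbij cf _] f0 f1]]|[f [cf f0 f1 finj ->]]]; last first.
  exists f; split=> //; apply: compact_homeomorphism_on => //.
  - exact: dendrite_hausdorff.
  - by exists 0; rewrite /= in_itv /= lexx ler01.
  - exact: segment_compact.
  - exact: continuous_subspaceT.
pose g (t : R) := f (Num.max 0 (Num.min 1 t)).
have gf t : 0 <= t <= 1 -> g t = f t.
  by move=> /andP[t0 t1]; rewrite /g min_r // max_r.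
exists g; split.
- by apply: continuous_clamp; [exact: ler01|exact: cf].
- by rewrite gf // lexx ler01.
- by rewrite gf // lexx ler01.
- move=> s t; rewrite !inE /= !in_itv /= => s01 t01; rewrite !gf //.
  by apply: (set_bij_inj fbij); rewrite inE /= in_itv.
- have -> : A = f @` `[0, 1].
    by apply/seteqP; split; [exact: set_bij_surj fbij|exact: set_bij_sub fbij].
  by apply: eq_imagel => t; rewrite /= in_itv /= => /gf.
Qed.

Lemma joining_arc_unique (x y : X) (A B : set X) :
  joining_arc R x y A -> joining_arc R x y B -> A = B.
Proof.
suff sub C D : joining_arc R x y C -> joining_arc R x y D -> C `<=` D.
  by move=> xyA xyB; apply/seteqP; split; exact: sub.
move=> /joining_arcP[f [cf f0 f1 finj ->]] /joining_arcP[g [cg g0 g1 ginj ->]].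
move=> w [s]; rewrite /= in_itv /= => s01 <-; apply: contrapT => ngs.
have [||t t01 fg|K] := distinct_arcs_curve dendrite_hausdorff cf cg finj ginj _ _ s01.
- by rewrite f0.
- by rewrite f1.
- by apply: ngs; exists t; rewrite //= in_itv.
- exact: no_curve.
Qed.

Lemma arc_joining (x y : X) (A : set X) : joining_arc R x y A -> Defs.arc R x y = A.
Proof.
move=> xyA; rewrite /Defs.arc; case: xgetP => [B _ xyB|/(_ A) //].
exact: joining_arc_unique xyB xyA.
Qed.

(** The default value of [xget] is empty, so a point of the arc certifies that an arc exists. *)
Lemma arcE (x y : X) : Defs.arc R x y !=set0 -> joining_arc R x y (Defs.arc R x y).
Proof. by rewrite /Defs.arc; case: xgetP => [B _ //|_ [z]]. Qed.

Lemma open_arc_separates (x y z : X) : open_arc R x y z -> ~ component z x y.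
Proof.
move=> [Az nz] xy.
have /joining_arcP[f [cf f0 f1 finj Af]] : joining_arc R x y (Defs.arc R x y).
  by apply: arcE; exists z.
have nxy : x <> y.
  rewrite -f0 -f1 => f01; suff : (0 : R) = 1 by move/eqP; rewrite eq_sym oner_eq0.
  by apply: finj; rewrite // inE /= in_itv /= lexx ler01.
have [xz yz] : x <> z /\ y <> z by split=> e; apply: nz; [left|right].
have [d dP] := X_metric.
have : path_in (R := R) (~` [set z]) x y.
  apply: (connected_path dP X_compact X_lc (C := component z x)) => //.
  - exact: open_compl1 dendrite_hausdorff _.
  - exact: connected_component_sub.
  - exact: component_connected.
  - exact: connected_component_refl.
move=> /(path_arc dP) /(_ nxy) [g [cg g0 g1 ginj gz]].
have gA : joining_arc R x y (g @` `[0, 1]) by apply/joining_arcP; exists g.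
by move: Az; rewrite (arc_joining gA) => -[t _ gtz]; apply: (gz t).
Qed.

(** If [z = f s], the part of [f] over [[0, s]] is an arc from [x] to [z], and by uniqueness it is
    the one that [arc] selects. *)
Lemma open_arc_sub (x y z : X) : open_arc R x y z ->
  x <> z /\ open_arc R x z `<=` open_arc R x y.
Proof.
move=> [Az nz]; have xyA : joining_arc R x y (Defs.arc R x y) by apply: arcE;
  exists z.
have /joining_arcP[f [cf f0 f1 finj Af]] := xyA.
have xz : x <> z by move=> e; apply: nz; left.
have yz : y <> z by move=> e; apply: nz; right.
split => //; move: Az; rewrite Af => -[s]; rewrite /= in_itv /= => /andP[s0 s1] fs.
have {}s0 : 0 < s by rewrite lt_neqAle s0 andbT; apply/eqP => e; apply: xz;
  rewrite -f0 e.
have {}s1 : s < 1 by rewrite lt_neqAle s1 andbT; apply/eqP => e; apply: yz;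
  rewrite -f1 -e.
have s01 t : 0 <= t <= 1 -> 0 <= s * t + 0 <= s by move=> /andP[t0 t1];
  rewrite addr0; nra.
have s01' t : 0 <= t <= s -> 0 <= t <= 1.
  by move=> /andP[-> ts]; exact: ltW (le_lt_trans ts s1).
have xzA : joining_arc R x z ((fun t => f (s * t + 0)) @` `[0, 1]).
  apply/joining_arcP; exists (fun t => f (s * t + 0)); split => //.
  - exact: continuous_affine cf.
  - by rewrite mulr0 addr0.
  - by rewrite mulr1 addr0.
  - move=> t u; rewrite !inE /= !in_itv /= => /s01 /s01' t01 /s01 /s01' u01 /finj e.
    have {}e : s * t + 0 = s * u + 0 by apply: e; rewrite inE /= in_itv.
    by move/addIr/mulfI: e; apply; rewrite gt_eqF.
rewrite /open_arc (arc_joining xzA) Af => w [[t]]; rewrite /= in_itv /= => t01 <- nw.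
split.
  by exists (s * t + 0) => //; rewrite in_itv /=; exact/s01'/s01.
move=> [e|e]; first by apply: nw; left.
(* The endpoint [y = f 1] is excluded because [s * t <= s < 1]. *)
have /eqP : s * t + 0 = 1.
  apply: finj; rewrite ?inE /= ?in_itv /= ?f1 //; first exact/s01'/s01.
  by rewrite ler01 lexx.
by have /andP[_] := s01 _ t01; move=> ? /eqP; lra.
Qed.

(** If the point [z] that avoids [s] happens to be the new forbidden point [w], the search is
    repeated in the open arc from [x] to [z], which excludes [z]. *)
Lemma open_arc_Br_infinite :
  (forall x y : X, x <> y -> (open_arc R x y `&` Br X) !=set0) ->
  forall (s : seq X) (x y : X), x <> y ->
    exists2 z, (open_arc R x y `&` Br X) z & z \notin s.
Proof.
move=> XBr; elim=> [|w s IHs] x y xy; first by have [z] := XBr x y xy; exists z.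
have [z [xyz Bz] zs] := IHs x y xy.
have [zw|nzw] := eqVneq z w; last by exists z => //; rewrite inE negb_or nzw.
have [xz sub] := open_arc_sub xyz; have [z' [xzz' Bz'] z's] := IHs x z xz.
exists z'; first by split => //; exact: sub.
rewrite inE negb_or z's andbT -zw; apply/eqP => e.
by case: xzz' => _; apply; right.
Qed.

End Dendrites.

(** * Colorings *)

Lemma countable_enumeration (T : Type) (Q : set T) : countable Q -> Q !=set0 ->
  exists E : nat -> T, (forall k, Q (E k)) /\ forall q, Q q -> exists k, E k = q.
Proof.
move=> /countable_injP[f finj] [q0 Qq0].
have /choice[E EP] : forall k, exists q, Q q /\ forall q', Q q' -> f q' = k -> q' = q.
  move=> k; have [[q Qq fq]|nq] := pselect (exists2 q, Q q & f q = k); last first.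
    by exists q0; split => // q Qq fq; case: nq; exists q.
  exists q; split => // q' Qq' fq'; apply: finj; rewrite ?inE //.
  by rewrite fq'.
exists E; split=> [k|q Qq]; first by have [] := EP k.
by exists (f q); have [_ /(_ q Qq erefl)] := EP (f q).
Qed.

(** Greedy choice: [L k] lists the values chosen before stage [k], and the next one avoids them. *)
Lemma injective_choice (T : eqType) (S : nat -> set T) :
  (forall k (s : seq T), exists2 z, S k z & z \notin s) ->
  exists2 f : nat -> T, injective f & forall k, S k (f k).
Proof.
move=> Sinf; have /choice[g gP] : forall ks : nat * seq T, exists z,
    S ks.1 z /\ z \notin ks.2.
  by move=> [k s]; have [z Sz zs] := Sinf k s; exists z.
pose L := fix L k := if k is k'.+1 then g (k', L k') :: L k' else [::].
have LP j k : (j < k)%N -> g (j, L j) \in L k.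
  elim: k => // k IHk; rewrite ltnS leq_eqVlt => /orP[/eqP ->|/IHk jk].
    by rewrite mem_head.
  by rewrite inE jk orbT.
exists (fun k => g (k, L k)) => [j k gjk|k]; last by have [] := gP (k, L k).
have [jk|kj|//] := ltngtP j k.
  by have [_] := gP (k, L k); rewrite -gjk LP.
by have [_] := gP (j, L j); rewrite gjk LP.
Qed.

(** * Homeomorphisms acting on components *)

Section Homeomorphisms.
Variable X : topologicalType.

Lemma image_component_sub (f : X -> X) (x y : X) : continuous f -> injective f ->
  y <> x -> f @` component x y `<=` component (f x) (f y).
Proof.
move=> cf finj yx; apply: connected_component_max.
- by exists y => //; exact: connected_component_refl.
- by move=> _ [z /connected_component_sub zx <-] /finj.
- apply: connected_continuous_connected; first exact: component_connected.
  exact: continuous_subspaceT.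
Qed.

Lemma image_component (f : X -> X) (x y : X) : homeomorphism f -> y <> x ->
  f @` component x y = component (f x) (f y).
Proof.
move=> [cf [g [cg fK gK]]] yx; apply/seteqP; split.
  exact: image_component_sub cf (can_inj fK) yx.
move=> z fz; exists (g z) => //; rewrite -[x]fK -[y]fK.
apply: (image_component_sub cg (can_inj gK)); last by exists z.
by move=> /(can_inj fK).
Qed.

Lemma image_components (f : X -> X) (x : X) : homeomorphism f ->
  image ^~ f @` components x = components (f x).
Proof.
move=> hf; have [_ [g [_ fK gK]]] := hf; apply/seteqP; split.
  move=> _ [_ [y yx <-] <-]; exists (f y); first by move=> /= /(can_inj fK).
  by rewrite image_component.
move=> _ [y yfx <-]; have gyx : g y <> x by move=> e; apply: yfx; rewrite /= -e gK.
by exists (component x (g y)); [exists (g y)|rewrite image_component // gK].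
Qed.

Lemma image_bij_components (f : X -> X) (x : X) : homeomorphism f ->
  set_bij (components x) (components (f x)) (image ^~ f).
Proof.
move=> hf; rewrite -(image_components x hf); apply: inj_bij.
have [_ [g [_ fK _]]] := hf => C D _ _ /(congr1 (image ^~ g)) /=.
by have gf : g \o f = id by [apply/funext]; rewrite !image_comp gf !image_id.
Qed.

Lemma homeomorphism_Br (f : X -> X) (x : X) : homeomorphism f -> Br X x -> Br X (f x).
Proof.
move=> hf Bx; apply: card_le_trans Bx _; rewrite -(image_components x hf).
have [_ finj _] := image_bij_components x hf.
by have := inj_card_eq finj; rewrite card_eq_le => /andP[].
Qed.

End Homeomorphisms.

Lemma countable_index_set n : countable [set: index_set n].
Proof. by apply/countable_injP; exists val => i j _ _ /val_inj. Qed.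

(** * Transported and twisted colorings *)

Section Coloring.
Context {R : realType} {n : option nat} {X : topologicalType}.
Variables (G : set (X -> X)) (x0 : X) (phi : set X -> index_set n).
Variable h : X -> X -> X.
Hypothesis G_homeo : homeo_group G.
Hypothesis phi_bij : set_bij (components x0) [set: index_set n] phi.
Hypothesis hP : forall x, Br X x -> G (h x) /\ h x x = x0.

Let Gamma := local_action_at G x0 phi.

(** At a branch point, another choice of [h x] in [G] would change this by an element of [Gamma],
    the same freedom that the twist exploits. *)
Definition base_coloring (x : X) (C : set X) : index_set n := phi (h x @` C).

Definition twisted_coloring (gam : X -> index_set n -> index_set n)
  (x : X) (C : set X) : index_set n := gam x (base_coloring x C).

Lemma base_coloring_bij x : Br X x ->
  set_bij (components x) [set: index_set n] (base_coloring x).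
Proof.
move=> Bx; have [Gh hx] := hP Bx.
have hh : homeomorphism (h x) by case: G_homeo => _; apply.
have := image_bij_components x hh; rewrite hx => hbij.
exact: set_bij_comp hbij phi_bij.
Qed.

Lemma twisted_coloring_coloring gam : perm_group Gamma -> (forall x, Gamma (gam x)) ->
  coloring (twisted_coloring gam).
Proof.
move=> [_ _ Gi] Ggam x Bx; have [g' _ [gK g'K]] := Gi _ (Ggam x).
apply: set_bij_comp (base_coloring_bij Bx) _; split => //.
- by move=> i j _ _ /(can_inj gK).
- by move=> i _; exists (g' i).
Qed.

(** The element [k] of [G] carries [x0] to [x], then to [g x], then back to [x0], so it induces some
    [s] in [Gamma]. The cocycle is [gam (g x)] after [s] after the inverse of [gam x]. *)
Lemma twisted_coloring_group gam : perm_group Gamma -> (forall x, Gamma (gam x)) ->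
  G `<=` kaleidoscopic_group (twisted_coloring gam) Gamma.
Proof.
move=> GammaG Ggam g Gg; have [Gamma_comp Ginv] : 
    (forall f g, Gamma f -> Gamma g -> Gamma (f \o g)) /\
    (forall f, Gamma f -> exists2 g, Gamma g & cancel f g /\ cancel g f).
  by case: GammaG.
have [[_ Gmul Ginv'] hG] := G_homeo.
have hg := hG _ Gg; split => // x Bx; have Bgx := homeomorphism_Br hg Bx.
have [Gx hx] := hP Bx; have [Ggx hgx] := hP Bgx.
have [h' Gh' [hK h'K]] := Ginv' _ Gx.
pose k := h (g x) \o (g \o h').
have Gk : stabilizer G x0 k.
  split; first by apply: (Gmul) => //; exact: Gmul.
  by rewrite /k /= -{1}hx hK hgx.
have /choice[psi psiP] : forall i :
  index_set n, exists C, components x0 C /\ phi C = i.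
  by move=> i; have [_ _ /(_ i I) [C xC Ci]] := phi_bij; exists C.
pose s i := phi (k @` psi i).
have sP C : components x0 C -> s (phi C) = phi (k @` C).
  move=> xC; rewrite /s; congr (phi (k @` _)); have [xpsi phipsi] := psiP (phi C).
  by case: phi_bij => _ + _; apply; rewrite ?inE.
have Gs : Gamma s by exists k.
have [gx' Ggx' [gK g'K]] := Ginv _ (Ggam x).
suff -> : local_cocycle (twisted_coloring gam) g x = gam (g x) \o (s \o gx').
  by apply: (Gamma_comp) => //; exact: Gamma_comp.
apply/funext => i; rewrite /local_cocycle /twisted_coloring /=; congr (gam _ _).
have cbij := twisted_coloring_coloring GammaG Ggam Bx.
(* [C] is the component at [x] whose twisted color is [i]; both sides are compared on it. *)
set C := 'pinv_ _ _ _ i.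
have [xC Ci] : components x C /\ gam x (base_coloring x C) = i.
  have csurj := set_bij_surj cbij; split; last first.
    exact: (surjpK (fun=> set0) csurj (mem_set I)).
  by apply: (surjpinv_image_sub (dflt := fun=> set0) csurj); exists i.
rewrite -Ci gK /base_coloring sP; last first.
  rewrite -hx -(image_components x (hG _ Gx)); exact: imageP.
have kh : k \o h x = h (g x) \o g by apply/funext => y; rewrite /k /= hK.
by rewrite !image_comp kh.
Qed.

Lemma kaleidoscopic_twist : doubly_transitive Gamma -> perm_group Gamma ->
  (forall x y : X, x <> y -> Br X x -> Br X y -> forall s : seq X,
    exists2 z, (open_arc R x y `&` Br X) z & z \notin s) ->
  (forall x y z : X, open_arc R x y z -> ~ component z x y) ->
  countable (Br X) ->
  exists gam, (forall x, Gamma (gam x)) /\ kaleidoscopic R (twisted_coloring gam).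
Proof.
move=> G2 GammaG arc_inf arc_sep cBr.
pose Q := [set q : X * X * (index_set n * index_set n) |
  [/\ Br X q.1.1, Br X q.1.2, q.1.1 <> q.1.2 & q.2.1 <> q.2.2]].
have cQ : countable Q.
  apply: (@sub_countable _ _ _ ((Br X `*` Br X) `*` ([set:
    index_set n] `*` [set: index_set n]))).
    by apply: subset_card_le => q [].
  by apply: countableX; apply: countableX => //; exact: countable_index_set.
have [G1 _ _] := GammaG.
(* The enumeration requires at least one condition; if there is none, the trivial twist suffices. *)
have [Q0|/set0P Q0] := eqVneq Q set0.
  exists (fun=> id); split => //; split; first exact: twisted_coloring_coloring.
  move=> x y i j Bx By xy ij; exfalso.
  by have : Q ((x, y), (i, j)) by []; rewrite Q0.
have [E [QE Esurj]] := countable_enumeration cQ Q0.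
have [|z zinj zP] := @injective_choice X (fun k =>
  open_arc R (E k).1.1 (E k).1.2 `&` Br X).
  by move=> k s; have [Bx By xy _] := QE k; exact: arc_inf.
(* At [z k] the twist answers the condition [E k] alone, because [z] is injective; at points not
   chosen it is the identity. *)
have /choice[gam gamP] : forall w, exists f, Gamma f /\ forall k, z k = w ->
    f (base_coloring w (component w (E k).1.1)) = (E k).2.1 /\
    f (base_coloring w (component w (E k).1.2)) = (E k).2.2.
  move=> w; have [[k zk]|nk] := pselect (exists k, z k = w); last first.
    by exists id; split => // k zk; case: nk; exists k.
  have [xyz Bz] := zP k; rewrite zk in xyz Bz; have [_ _ _ ij] := QE k.
  have sep := arc_sep _ _ _ xyz; have [_ nz] := xyz.
  have [xw yw] : (E k).1.1 <> w /\ (E k).1.2 <> w by split=> e; apply: nz;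
    [left|right].
  (* Double transitivity moves only pairs of distinct colors; separation by [w] provides them. *)
  have ncol : base_coloring w (component w (E k).1.1) <>
      base_coloring w (component w (E k).1.2).
    move=> e; apply: sep; have -> : component w (E k).1.1 = component w (E k).1.2.
      have [_ + _] := base_coloring_bij Bz; apply => //; rewrite inE.
        by exists (E k).1.1.
      by exists (E k).1.2.
    exact: connected_component_refl.
  have [f Gf fE] := G2 _ _ _ _ ncol ij; exists f; split => // k' zk'.
  by have -> : k' = k by apply: zinj; rewrite zk zk'.
exists gam; split; first by move=> w; case: (gamP w).
split; first by apply: twisted_coloring_coloring => // w; case: (gamP w).
move=> x y i j Bx By xy ij; have [|k Ek] := Esurj ((x, y), (i, j)); first by [].
exists (z k); first by have := zP k; rewrite Ek.
by have [_ /(_ k erefl)] := gamP (z k); rewrite Ek.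
Qed.

End Coloring.

Theorem theorem1p11 (R : realType) (n : option nat) (X : topologicalType)
    (G : set (X -> X)) (Gamma : set (index_set n -> index_set n))
    (n_ge3 : at_least3 n) (X_wazewski : wazewski R n X)
    (G_homeo : homeo_group G) (G_transitive : transitive_on G (Br X))
    (Gamma_group : perm_group Gamma)
    (G_Gamma : represents_local_action G Gamma)
    (Gamma_2transitive : doubly_transitive Gamma) :
  exists2 c : X -> set X -> index_set n,
    kaleidoscopic R c & G `<=` kaleidoscopic_group c Gamma.
Proof.
have [x0 Bx0 [phi phi_bij GammaE]] := G_Gamma.
have [X_dendrite _ _ X_Br] := X_wazewski.
have /choice[h hP] : forall x, exists g, Br X x -> G g /\ g x = x0.
  move=> x; have [Bx|nBx] := pselect (Br X x); last by exists id.
  by have [g Gg gx] := G_transitive x x0 Bx Bx0; exists g.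
rewrite {}GammaE in Gamma_group Gamma_2transitive *.
have [|||gam [Ggam kal]] := kaleidoscopic_twist (R :=
  R) G_homeo phi_bij hP Gamma_2transitive Gamma_group.
- by move=> x y xy _ _ s; exact: open_arc_Br_infinite X_dendrite X_Br s x y xy.
- by move=> x y z; exact: open_arc_separates.
- exact: countable_Br X_dendrite.
exists (twisted_coloring phi h gam) => //.
exact: twisted_coloring_group.
Qed.
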